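(* Let $1<p<\infty$, let $w\in A_p^{\mathcal{D}}$ be a weight on $\mathbb{R}$, and let $\mathcal{S}\subset\mathcal{D}$ be a sparse collection of dyadic intervals with Carleson constant $\Lambda$ and with no infinitely increasing chains. Then the weighted sparse operator $\mathcal{A}_{\mathcal{S}}^wf:=\sum_{I\in\mathcal{S}}\langle w\rangle_I\langle f\rangle_I\mathbf{1}_I$ may be expressed as $$\mathcal{A}_{\mathcal{S}}^wf=\Pi_{b_{\mathcal{S}}^w}f+\Pi^*_{b_{\mathcal{S}}^w}f+T_{\tau_{\mathcal{S}}^w}f,$$ where the first two terms are the paraproducts with symbol $b_{\mathcal{S}}^w:=\sum_{I\in\mathcal{S}}\langle w\rangle_I\mathbf{1}_I$, the sparse $BMO^{\mathcal{D}}(w)$ function associated with $\mathcal{S}$ and $w$, and the third term is $$T_{\tau_{\mathcal{S}}^w}f(x):=\sum_{J\in\mathcal{D}}(\tau_{\mathcal{S}}^w)_J(f,h_J)h_J(x),\qquad\text{where }(\tau_{\mathcal{S}}^w)_J:=\frac1{|J|}\sum_{I\in\mathcal{S},\,I\subsetneq J}w(I)\le[w]_{A_p}\Lambda^p\langle w\rangle_J\quad\text{for all }J\in\mathcal{D}.$$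
   Context: $\mathcal{D}$ is a fixed dyadic grid on $\mathbb{R}$: a collection of intervals of lengths $2^k$, $k\in\mathbb{Z}$, such that for each fixed $k$ those of length $2^k$ partition $\mathbb{R}$, and $I\cap J\in\{I,J,\emptyset\}$ for all $I,J\in\mathcal{D}$. $\mathcal{S}\subset\mathcal{D}$ has Carleson constant $\Lambda>1$ (is $\Lambda$-Carleson) if $\sum_{I\in\mathcal{S},I\subset J}|I|\le\Lambda|J|$ for all $J\in\mathcal{D}$; it is sparse if it is $\Lambda$-Carleson for some $\Lambda>1$ (equivalently, for some $\eta\in(0,1)$ there are pairwise disjoint measurable $E_I\subset I$, $I\in\mathcal{S}$, with $|E_I|\ge\eta|I|$; one may take $\eta=1/\Lambda$). $\mathcal{S}$ has an infinitely increasing chain if there are $I_k\in\mathcal{S}$, $k\in\mathbb{N}$, with $I_k\subsetneq I_{k+1}$ for all $k$. $h_I=|I|^{-1/2}(\mathbf{1}_{I_+}-\mathbf{1}_{I_-})$ with $I_+,I_-$ the right and left halves of $I$; $(f,g)=\int fg\,dx$; $\langle f\rangle_I=\frac1{|I|}\int_If\,dx$; $w(I)=\int_Iw\,dx$. A weight is a locally integrable, a.e. positive function. With $1/p+1/p'=1$ and $w'=w^{1-p'}$, $w\in A_p^{\mathcal{D}}$ means $[w]_{A_p}:=\sup_{I\in\mathcal{D}}\langle w\rangle_I\langle w'\rangle_I^{p-1}<\infty$. $BMO^{\mathcal{D}}(w)$ is the space of $b$ with $\sup_{I\in\mathcal{D}}\frac1{w(I)}\int_I|b-\langle b\rangle_I|\,dx<\infty$.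 The paraproducts with symbol $b$ are $\Pi_bf=\sum_{I\in\mathcal{D}}(b,h_I)\langle f\rangle_Ih_I$ and $\Pi_b^*f=\sum_{I\in\mathcal{D}}(b,h_I)(f,h_I)\frac{\mathbf{1}_I}{|I|}$.
   Formalization: The identity is proved a.e., with series summed by scale, for locally integrable f such that the sum of ⟨w⟩_J|⟨f⟩_J| over J in D containing K is finite for every K in D; for arbitrary f it fails, e.g. w=f=1, S={[2^n,2^(n+1)): n≥0}. *)

(* Defs.v *)
From HB Require Import structures.
From mathcomp Require Import all_boot all_order all_algebra.
From mathcomp Require Import all_classical all_reals all_analysis.
Set Implicit Arguments.
Unset Strict Implicit.
Unset Printing Implicit Defensive.
Import Order.TTheory GRing.Theory Num.Theory numFieldNormedType.Exports.
Local Open Scope classical_set_scope.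
Local Open Scope ring_scope.

Section dyadic.
Context {R : realType}.
Implicit Types (p : R) (D S : set (set R)) (I J K : set R) (w b f g : R -> R).

Local Notation mu := (@lebesgue_measure R).

Definition len I : R := fine (mu I).

(* The intervals may be open, closed or half-open. The second clause says that
   for each k the members of length 2^k partition the line. *)
Definition dyadic_grid D : Prop :=
  [/\ forall I, D I -> is_interval I /\ exists k : int, mu I = (2 ^ k)%:E,
      forall (k : int) (x : R),
        exists! I, [/\ D I, mu I = (2 ^ k)%:E & I x] &
      forall I J, D I -> D J ->
        [\/ I `&` J = I, I `&` J = J | I `&` J = set0]].

Definition midpoint I : R := (inf I + sup I) / 2.
Definition left_half I : set R := I `&` [set x | x < midpoint I].
Definition right_half I : set R := I `&` [set x | midpoint I <= x].

Definition haar I : R -> R := fun x =>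
  (Num.sqrt (len I))^-1 * (\1_(right_half I) x - \1_(left_half I) x).

Definition inner f g : R := Rintegral mu setT (fun x => f x * g x).

Definition avg f I : R := (len I)^-1 * Rintegral mu I f.

Definition wmass w I : \bar R := (\int[mu]_(x in I) (w x)%:E)%E.

Definition eavg w I : \bar R := ((len I)^-1%:E * wmass w I)%E.

Definition is_weight w : Prop :=
  locally_integrable setT w /\ {ae mu, forall x, 0 < w x}.

Definition conj_exp p : R := (1 - p^-1)^-1.

Definition dual_weight p w : R -> R := fun x => w x `^ (1 - conj_exp p).

Definition Ap_const D p w : \bar R :=
  ereal_sup [set (eavg w I * (eavg (dual_weight p w) I) `^ (p - 1))%E | I in D].

Definition Ap D p w : Prop := is_weight w /\ (Ap_const D p w < +oo)%E.

Definition BMO D w b : Prop :=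
  locally_integrable setT b /\
  (ereal_sup [set (wmass w I)^-1 * \int[mu]_(x in I) `|b x - avg b I|%:E
             | I in D] < +oo)%E.

Definition Carleson D S (L : R) : Prop :=
  [/\ S `<=` D, 1 < L &
      forall J, D J -> (\esum_(I in [set I | S I /\ I `<=` J]) mu I
                        <= L%:E * mu J)%E].

Definition infinite_increasing_chain S : Prop :=
  exists I : nat -> set R, forall k, S (I k) /\ I k `<` I k.+1.

(* The sum is finite at every point that lies in finitely many members of S;
   elsewhere the finitely supported sum defaults to 0. *)
Definition sparse_op S w f : R -> R := fun x =>
  \sum_(I \in S) avg w I * avg f I * \1_I x.

Definition sparse_symbol S w : R -> R := fun x =>
  fine (\esum_(I in S) (avg w I * \1_I x)%:E).

Definition tau S w J : \bar R :=
  ((len J)^-1%:E * \esum_(I in [set I | S I /\ I `<` J]) wmass w I)%E.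

(* Series over the grid are summed by scale. When F J vanishes off J, only the
   single interval of each length 2^k containing x contributes at x, so the
   series is a bilateral series in k; its two ends converge independently. *)
Definition dyadic_psum D (F : set R -> R -> R) (x : R) (mn : nat * nat) : R :=
  \sum_(J \in [set J | D J /\ 2 ^- mn.1 <= len J <= 2 ^+ mn.2]) F J x.

Definition dyadic_summable D (F : set R -> R -> R) (x : R) : Prop :=
  cvg (dyadic_psum D F x @ filter_prod \oo \oo).

Definition dyadic_sum D (F : set R -> R -> R) (x : R) : R :=
  lim (dyadic_psum D F x @ filter_prod \oo \oo).

Definition paraproduct_term b f J : R -> R := fun x =>
  inner b (haar J) * avg f J * haar J x.

Definition paraproduct_adj_term b f J : R -> R := fun x =>
  inner b (haar J) * inner f (haar J) * (\1_J x / len J).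

Definition haar_multiplier_term (t : set R -> R) f J : R -> R := fun x =>
  t J * inner f (haar J) * haar J x.

Definition paraproduct D b f : R -> R := dyadic_sum D (paraproduct_term b f).

Definition paraproduct_adj D b f : R -> R :=
  dyadic_sum D (paraproduct_adj_term b f).

Definition haar_multiplier D (t : set R -> R) f : R -> R :=
  dyadic_sum D (haar_multiplier_term t f).

(* Domain of the operators. The second clause controls the large scales of
   the three Haar series; some decay is necessary. For instance, on a grid
   containing [0, 2^n) for all n, w = 1, S = {[2^n, 2^(n+1)) : n >= 0} and
   f = 1 give the operator values 1 and 0 on the two sides at x >= 1.
   The clause holds trivially for finite Haar sums, and it also holds for f in
   L^p(u) when w = u^(1/p) v^(-1/p) with u and v in A_p. *)
Definition sparse_domain D w f : Prop :=
  locally_integrable setT f /\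
  forall K, D K ->
    (\esum_(J in [set J | D J /\ K `<=` J]) (avg w J * `|avg f J|)%:E
     < +oo)%E.

End dyadic.

(* Main.v *)
Require Import Defs.
From HB Require Import structures.
From mathcomp Require Import all_boot all_order all_algebra.
From mathcomp Require Import all_classical all_reals all_analysis.
From mathcomp Require Import measurable_realfun.
From mathcomp Require Import ring lra zify.
Import Order.TTheory GRing.Theory Num.Theory numFieldNormedType.Exports.
Local Open Scope classical_set_scope.
Local Open Scope ring_scope.
Set Implicit Arguments.
Unset Strict Implicit.
Unset Printing Implicit Defensive.

(** For J in the grid let F_J be the average of f, w_J that of w, b_J that of the
    symbol b, and tau_J = (1/|J|) times the sum of w(I) over the members I of S
    properly inside J. The members of S that contain J contribute a constant to b on
    J, and those inside J have mean tau_J; so b_J is tau_J plus a constant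
    ([avg_symbol]). In passing to a child K of J the constant grows by w_K exactly
    if K is in S ([symbol_increment]).

    For x in the child K the terms of the three series at J are (b_K - b_J) F_J,
    (b_K - b_J) (F_K - F_J) and tau_J (F_K - F_J), and their sum is
    tau_K F_K - tau_J F_J, plus w_K F_K if K is in S ([telescope_terms]). Summed
    over the cells of x this telescopes to the sparse operator, provided that
    tau_J F_J vanishes at both ends ([three_terms_cvg]). At small cells F_J
    converges and tau_J tends to 0 by Lebesgue differentiation of f and of b
    ([tau_cvg0]). At large cells tau_J <= C w_J, and the sum of w_J |F_J| is finite
    by the choice of the domain.

    The series must also converge one by one. At large cells the first and the
    third are dominated by the sum of w_J |F_J|, with the help of the doubling
    property of w ([Ap_doubling]). At small cells convergence need not be absolute:
    they are martingale transforms of integrable functions by multipliers that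
    are bounded along almost every chain of cells, and such transforms converge
    almost everywhere ([transform_cvg]). That is proved by stopping, which makes the
    energy finite, and by a maximal inequality obtained by induction on the
    children. The second series is what remains of the telescoping sum.

    The bound on tau distributes |I| / L of mass within each member I of a finite
    subfamily, with total density at most 1, as the Carleson condition allows
    ([carleson_density]), and tests the weight against these densities by
    Hölder's inequality ([Ap_testing]). It also controls the mean oscillation of b,
    which on J is at most 2 tau_J ([symbol_oscillation]), and by the Carleson
    condition and the absence of infinite chains almost every point lies in
    finitely many members of S ([ae_finite_members]). *)

(** * Intervals and dyadic grids *)

Section interval_geometry.
Context {R : realType}.
Implicit Types (I J K : set R) (c x : R).
Local Notation mu := (@lebesgue_measure R).

(** The endpoints may or may not belong to the interval. Later arguments avoid
    them: they take points strictly between the endpoints. *)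
Lemma interval_between_endpoints I c : 0 < c -> is_interval I -> mu I = c%:E ->
  [/\ `]inf I, sup I[ `<=` I, I `<=` `[inf I, sup I] & sup I - inf I = c].
Proof.
move=> c0 /is_intervalP; set H := Rhull I => IE.
have HE : H = Rhull I by [].
move=> /[dup] mI; rewrite {1}IE => mI1.
have I0 : I !=set0.
  apply/set0P; apply/eqP => I0; move: mI; rewrite I0 measure0 => -[] c0'.
  by rewrite -c0' ltxx in c0.
move: mI1; rewrite HE lebesgue_measure_itv /=.
case: (asboolP (has_lbound I)) => hl; case: (asboolP (has_ubound I)) => hu //=; last 2 first.
- by rewrite ltry.
- by rewrite ltNyr.
have hI : has_inf I by split.
have hS : has_sup I by split.
case: ifPn; last by move=> _ [] c0'; rewrite -c0' ltxx in c0.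
move=> _ [] E; split => //.
  rewrite [X in _ `<=` X]IE HE => x /=; rewrite in_itv/= => /andP[a b].
  rewrite /Rhull (asboolT hl) (asboolT hu) in_itv/=; apply/andP; split.
    by case: asbool => /=; rewrite ?ltW.
  by case: asbool => /=; rewrite ?ltW.
move=> x Ix; rewrite /= in_itv/=; apply/andP; split.
  exact: ge_inf.
exact: ub_le_sup.
Qed.
End interval_geometry.

Section grid.
Context {R : realType} {D : set (set R)} (hD : dyadic_grid D).
Implicit Types (I J K : set R) (x : R) (k : int).
Local Notation mu := (@lebesgue_measure R).

Lemma grid_measurable I : D I -> measurable I.
Proof. by case: hD => + _ _ => /[apply] -[/is_interval_measurable]. Qed.

Lemma grid_len I : D I -> exists k, len I = 2 ^ k.
Proof. by case: hD => + _ _ => /[apply] -[_ [k E]]; exists k; rewrite /len E. Qed.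

Lemma grid_mu I : D I -> mu I = (len I)%:E.
Proof. by case: hD => + _ _ => /[apply] -[_ [k E]]; rewrite /len E. Qed.

Lemma len_gt0 I : D I -> 0 < len I.
Proof. by move=> /grid_len [k ->]; rewrite exprz_gt0. Qed.

Lemma grid_unique I J x : D I -> D J -> len I = len J -> I x -> J x -> I = J.
Proof.
move=> DI DJ IJ Ix Jx; have [k Ik] := grid_len DI.
case: hD => _ /(_ k x) [K [_ KU]] _.
by rewrite -(KU I) ?(KU J)//; split => //; rewrite grid_mu -?IJ ?Ik.
Qed.

Lemma grid_subset_len I J : D I -> D J -> I `<=` J -> len I <= len J.
Proof.
move=> DI DJ IJ; rewrite -lee_fin -!grid_mu//.
by apply: le_measure => //; rewrite inE; exact: grid_measurable.
Qed.

(** The grid axiom leaves the case J = I `&` J open; then the lengths agree, and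
    the partition of the line at that length forces I = J. *)
Lemma grid_nested I J x : D I -> D J -> len I <= len J -> I x -> J x -> I `<=` J.
Proof.
move=> DI DJ IJ Ix Jx; case: hD => _ _ /(_ I J DI DJ) [/setIidPl//| |I0].
  move=> /setIidPr JI; suff -> : I = J by [].
  apply: (@grid_unique _ _ x) => //; apply/eqP; rewrite eq_le IJ/=.
  exact: grid_subset_len.
by have : (I `&` J) x by []; rewrite I0.
Qed.

Lemma grid_neq0 I : D I -> I !=set0.
Proof.
move=> DI; apply/set0P/eqP => I0; have := len_gt0 DI.
by rewrite /len I0 measure0 ltxx.
Qed.

Lemma pow2_gap (k l : int) : (2 : R) ^ k < 2 ^ l -> (2 : R) ^ k <= 2 ^ l / 2.
Proof.
rewrite ltr_eXz2l ?ltr1n// => kl.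
have -> : (2 : R) ^ l / 2 = 2 ^ (l - 1) by rewrite expfzDr// exprN1.
by rewrite ler_eXz2l ?ltr1n// lerBrDr lezD1.
Qed.

(** Lengths are powers of two, so a proper inclusion at least halves them. *)
Lemma grid_proper_len I J : D I -> D J -> I `<` J -> len I <= len J / 2.
Proof.
move=> DI DJ [IJ JI]; have := grid_subset_len DI DJ IJ.
rewrite le_eqVlt => /predU1P[E|].
  exfalso; have [x Ix] := grid_neq0 DI; apply: JI.
  by rewrite (grid_unique DI DJ E Ix (IJ _ Ix)).
by have [k ->] := grid_len DI; have [l ->] := grid_len DJ; exact: pow2_gap.
Qed.

Definition cell k x := xget set0 [set I | [/\ D I, len I = 2 ^ k & I x]].

Lemma cellP k x : [/\ D (cell k x), len (cell k x) = 2 ^ k & cell k x x].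
Proof.
case: hD => _ /(_ k x) [I [[DI Ik Ix] _]] _.
by rewrite /cell; case: xgetP => // /(_ I)[]; split => //; rewrite /len Ik.
Qed.

Lemma cell_grid k x : D (cell k x). Proof. by case: (cellP k x). Qed.
Lemma len_cell k x : len (cell k x) = 2 ^ k. Proof. by case: (cellP k x). Qed.
Lemma mem_cell k x : cell k x x. Proof. by case: (cellP k x). Qed.

Lemma cell_eq I k x : D I -> len I = 2 ^ k -> I x -> I = cell k x.
Proof.
move=> DI Ik Ix; have [? ? ?] := cellP k x.
by apply: (@grid_unique _ _ x) => //; rewrite Ik.
Qed.

Lemma eq_cell k x y : cell k x y -> cell k y = cell k x.
Proof. by move=> xy; apply/esym/cell_eq => //; [exact: cell_grid|exact: len_cell]. Qed.

Lemma cell_subset k l x : (k <= l) -> cell k x `<=` cell l x.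
Proof.
move=> kl; apply: (@grid_nested _ _ x); rewrite ?len_cell;
  try exact: cell_grid; try exact: mem_cell.
by rewrite ler_eXz2l ?ltr1n.
Qed.

Lemma grid_bounds I : D I ->
  [/\ `]inf I, sup I[ `<=` I, I `<=` `[inf I, sup I] & sup I - inf I = len I].
Proof.
move=> DI; apply: interval_between_endpoints; [exact: len_gt0| |exact: grid_mu].
by case: hD => + _ _ => /(_ _ DI)[].
Qed.

End grid.
Arguments cell {R} D k x.

Section grid_covering.
Context {R : realType} {D : set (set R)} (hD : dyadic_grid D).
Implicit Types (I J K : set R) (x : R) (k : int).
Local Notation mu := (@lebesgue_measure R).

(** The multiples of |I| / 2 are closer to each other than the length of I, so
    one of them lies in the interior of I. Thus integers index the members of
    each length. *)
Lemma grid_half_multiple I : D I -> exists m : int, I (m%:~R * (len I / 2)).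
Proof.
move=> DI; have [iI _ II] := grid_bounds hD DI; have I0 := len_gt0 hD DI.
exists (Num.floor ((inf I + sup I) / len I)); apply: iI; rewrite /= in_itv/=.
have h0 : 0 < len I / 2 by rewrite divr_gt0.
set q := (inf I + sup I) / len I.
have qE : q * (len I / 2) = (inf I + sup I) / 2 by rewrite /q; field; rewrite gt_eqF.
have := floor_itv q; rewrite -(ler_pM2r h0) -(ltr_pM2r h0) qE => /andP[a b].
apply/andP; split; last by lra.
by move: b; rewrite intrD mulr1z [X in _ < X]mulrDl mul1r; lra.
Qed.

Lemma grid_countable : countable D.
Proof.
apply: (@sub_countable _ _ _
  [set cell D km.1 (km.2%:~R * (2 ^ km.1 / 2)) | km in [set: int * int]]).
  apply: subset_card_le => I DI; have [k Ik] := grid_len hD DI.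
  have [m Im] := grid_half_multiple DI; exists (k, m) => //=; apply/esym.
  by apply: (cell_eq hD) => //; rewrite -Ik.
exact: (card_le_trans (card_image_le _ _) (countableP _)).
Qed.

(** The unit cells that meet [-M, M] contain half-integers in [-M-1, M+1], of
    which there are 4 M + 5; the shift makes their numerators natural. *)
Lemma unit_cells_cover_ball (M : nat) x : `|x| <= M%:R ->
  exists2 i : nat, (i < (4 * M + 5))%N & cell D 0 ((i%:R - (2 * M + 2)%:R) / 2) x.
Proof.
move=> xM; have [m Im] := grid_half_multiple (cell_grid hD 0 x).
have E := len_cell hD 0 x; rewrite expr0z in E.
have [_ sub II] := grid_bounds hD (cell_grid hD 0 x); rewrite E in Im II.
have := sub _ Im; have := sub _ (mem_cell hD 0 x).
rewrite /= !in_itv/= => /andP[a b] /andP[c d].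
move: xM; rewrite ler_norml => /andP[xM Mx].
have : - (2 * M + 2)%:R <= (m%:~R : R) <= (2 * M + 2)%:R.
  rewrite natrD natrM; apply/andP; split; lra.
rewrite -[X in - X <= _ <= X -> _]/(((2 * M + 2)%:Z)%:~R).
rewrite -[X in X <= _ <= _ -> _]intrN !ler_int => /andP[m1 m2].
have m0 : (0 <= m + (2 * M + 2)%:Z) by rewrite -lerBlDr sub0r.
have nE := gez0_abs m0; set n := absz _ in nE; exists n.
  by rewrite -ltz_nat nE; lia.
have -> : (n%:R - (2 * M + 2)%:R) / 2 = m%:~R * (1 / 2) :> R.
  by rewrite -[n%:R]/((n%:Z)%:~R) nE intrD -pmulrn; lra.
by rewrite (eq_cell hD Im); exact: mem_cell.
Qed.

Lemma unit_cells_cover : [set: R] `<=` \bigcup_(m : int) cell D 0 (m%:~R / 2).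
Proof.
move=> x _; have [m Im] := grid_half_multiple (cell_grid hD 0 x).
rewrite (len_cell hD) expr0z div1r in Im; exists m => //=.
by rewrite (eq_cell hD Im); exact: mem_cell.
Qed.

End grid_covering.

Section children.
Context {R : realType} {D : set (set R)} (hD : dyadic_grid D).
Implicit Types (I J K : set R) (x y : R) (k : int).
Local Notation mu := (@lebesgue_measure R).

Lemma child_at J y : D J -> J y ->
  exists K, [/\ D K, len K = len J / 2, K y & K `<=` J].
Proof.
move=> DJ Jy; have [k Jk] := grid_len hD DJ.
have E : (2 : R) ^ (k - 1) = 2 ^ k / 2 by rewrite expfzDr// exprN1.
exists (cell D (k - 1) y); split;
  [exact: cell_grid|by rewrite len_cell// Jk E|exact: mem_cell|].
apply: (@grid_nested _ _ hD _ _ y) => //; [exact: cell_grid| |exact: mem_cell].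
rewrite len_cell// E Jk; have : 0 < (2 : R) ^ k by rewrite exprz_gt0.
lra.
Qed.

(** Each child is singled out by an interior point, at a quarter or at three
    quarters of J, because the grid decides which child owns the midpoint. *)
Definition lchild J := xget set0 [set I | [/\ D I, len I = len J / 2,
  I (inf J + len J / 4) & I `<=` J]].
Definition rchild J := xget set0 [set I | [/\ D I, len I = len J / 2,
  I (inf J + len J * 3 / 4) & I `<=` J]].

Lemma grid_mem J y : D J -> inf J < y < inf J + len J -> J y.
Proof.
move=> DJ /andP[a b]; have [iJ _ JJ] := grid_bounds hD DJ.
by apply: iJ; rewrite /= in_itv/= a/=; lra.
Qed.

Lemma grid_mem_le J y : D J -> J y -> inf J <= y <= inf J + len J.
Proof.
move=> DJ Jy; have [_ sJ JJ] := grid_bounds hD DJ.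
by have := sJ _ Jy; rewrite /= in_itv/= => /andP[-> /=]; lra.
Qed.

Lemma lchildP J : D J -> [/\ D (lchild J), len (lchild J) = len J / 2,
  lchild J (inf J + len J / 4) & lchild J `<=` J].
Proof.
move=> DJ; have J0 := len_gt0 hD DJ.
have [|K HK] := @child_at J (inf J + len J / 4) DJ; last first.
  by rewrite /lchild; case: xgetP => [I _ []|/(_ K HK)].
by apply: grid_mem => //; lra.
Qed.

Lemma rchildP J : D J -> [/\ D (rchild J), len (rchild J) = len J / 2,
  rchild J (inf J + len J * 3 / 4) & rchild J `<=` J].
Proof.
move=> DJ; have J0 := len_gt0 hD DJ.
have [|K HK] := @child_at J (inf J + len J * 3 / 4) DJ; last first.
  by rewrite /rchild; case: xgetP => [I _ []|/(_ K HK)].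
by apply: grid_mem => //; lra.
Qed.

Lemma grid_inf_sub I J : D I -> D J -> I `<=` J ->
  inf J <= inf I /\ inf I + len I <= inf J + len J.
Proof.
move=> DI DJ IJ; have I0 := len_gt0 hD DI; split; rewrite leNgt; apply/negP => h.
  set m := Num.min (inf J) (inf I + len I).
  have [a b] : inf I < m /\ m <= inf J.
    by rewrite lt_min h/= ltrDl I0; split=> //; rewrite ge_min lexx.
  have c : m <= inf I + len I by rewrite ge_min lexx orbT.
  have /IJ/(grid_mem_le DJ) : I ((inf I + m) / 2).
    by apply: grid_mem => //; lra.
  lra.
set m := Num.max (inf J + len J) (inf I).
have [a b] : m < inf I + len I /\ inf J + len J <= m.
  by rewrite gt_max h/= ltrDl I0; split => //; rewrite le_max lexx.
have c : inf I <= m by rewrite le_max lexx orbT.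
have /IJ/(grid_mem_le DJ) : I ((m + (inf I + len I)) / 2).
  by apply: grid_mem => //; lra.
lra.
Qed.

(** Otherwise some K of half the length lies in J and contains a point to the
    left of the child. There is no room for K beside the child, so that both
    contain the point at 3/8 of J, and they coincide. *)
Lemma lchild_inf J : D J -> inf (lchild J) = inf J.
Proof.
move=> DJ; have J0 := len_gt0 hD DJ; have [Dl ll lx lJ] := lchildP DJ.
have [a b] := grid_inf_sub Dl DJ lJ.
apply/eqP; rewrite eq_le a andbT leNgt; apply/negP => h.
have c := grid_mem_le Dl lx.
set y := (inf J + inf (lchild J)) / 2.
have Jy : J y by apply: grid_mem => //; rewrite /y; lra.
have [K [DK lK Ky KJ]] := child_at DJ Jy.
have d := grid_mem_le DK Ky; have [e f] := grid_inf_sub DK DJ KJ.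
have lz : lchild J (inf J + len J * 3 / 8) by apply: grid_mem => //; lra.
have Kz : K (inf J + len J * 3 / 8) by apply: grid_mem => //; rewrite /y in d; lra.
have KE : K = lchild J by apply: (grid_unique hD DK Dl _ Kz lz); rewrite lK ll.
by move: Ky; rewrite KE => /(grid_mem_le Dl); rewrite /y; lra.
Qed.

(** The mirror image: the common point is now at 5/8 of J. *)
Lemma rchild_inf J : D J -> inf (rchild J) = inf J + len J / 2.
Proof.
move=> DJ; have J0 := len_gt0 hD DJ; have [Dl ll lx lJ] := rchildP DJ.
have [a b] := grid_inf_sub Dl DJ lJ.
apply/eqP; rewrite eq_le andbC leNgt; apply/andP; split.
  apply/negP => h.
  have c := grid_mem_le Dl lx.
  set y := (inf J + len J + (inf (rchild J) + len J / 2)) / 2.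
  have Jy : J y by apply: grid_mem => //; rewrite /y; lra.
  have [K [DK lK Ky KJ]] := child_at DJ Jy.
  have d := grid_mem_le DK Ky; have [e f] := grid_inf_sub DK DJ KJ.
  have lz : rchild J (inf J + len J * 5 / 8) by apply: grid_mem => //; lra.
  have Kz : K (inf J + len J * 5 / 8) by apply: grid_mem => //; rewrite /y in d; lra.
  have KE : K = rchild J by apply: (grid_unique hD DK Dl _ Kz lz); rewrite lK ll.
  by move: Ky; rewrite KE => /(grid_mem_le Dl); rewrite /y; lra.
lra.
Qed.

Lemma children_disj J x : D J -> lchild J x -> rchild J x -> False.
Proof.
move=> DJ lx rx; have J0 := len_gt0 hD DJ.
have [Dl ll _ _] := lchildP DJ; have [Dr lr _ _] := rchildP DJ.
have E : lchild J = rchild J.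
  by apply: (grid_unique hD Dl Dr _ lx rx); rewrite lr.
have := lchild_inf DJ; rewrite E rchild_inf//; lra.
Qed.

Lemma children_cover J x : D J -> J x -> lchild J x \/ rchild J x.
Proof.
move=> DJ Jx; have J0 := len_gt0 hD DJ.
have [Dl ll _ _] := lchildP DJ; have [Dr lr _ _] := rchildP DJ.
have li := lchild_inf DJ; have ri := rchild_inf DJ.
have [K [DK lK Kx KJ]] := child_at DJ Jx; have [a b] := grid_inf_sub DK DJ KJ.
have [h|h] := ltP (inf K) (inf J + len J / 2).
  have Kz : K ((inf K + inf J + len J / 2) / 2) by apply: grid_mem => //; lra.
  have lz : lchild J ((inf K + inf J + len J / 2) / 2) by apply: grid_mem => //; lra.
  by left; rewrite -(grid_unique hD DK Dl _ Kz lz)// lK.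
have Kz : K (inf K + len K / 2) by apply: grid_mem => //; lra.
have lz : rchild J (inf K + len K / 2) by apply: grid_mem => //; lra.
by right; rewrite -(grid_unique hD DK Dr _ Kz lz)// lK.
Qed.

Lemma childrenU J : D J -> J = lchild J `|` rchild J.
Proof.
move=> DJ; apply/seteqP; split => x; first exact: children_cover.
by have [_ _ _ l] := lchildP DJ; have [_ _ _ r] := rchildP DJ; case; [exact: l|exact: r].
Qed.

(** Halves and children of J can differ at the midpoint, and only there. *)
Lemma haarE J x : D J -> x != midpoint J ->
  haar J x = (Num.sqrt (len J))^-1 * (\1_(rchild J) x - \1_(lchild J) x).
Proof.
move=> DJ; have [_ _ JJ] := grid_bounds hD DJ.
have [Dl ll _ lJ] := lchildP DJ; have [Dr lr _ rJ] := rchildP DJ => xm.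
have li := lchild_inf DJ; have ri := rchild_inf DJ.
have mE : midpoint J = inf J + len J / 2 by rewrite /midpoint -JJ; lra.
rewrite mE in xm.
rewrite /haar; congr (_ * (_ - _)); rewrite !indicE; congr (_%:R);
  congr nat_of_bool; apply/idP/idP; rewrite !inE.
- move=> [Jx /=]; rewrite mE => h; have [|//] := children_cover DJ Jx.
  move=> /(grid_mem_le Dl); rewrite li ll => /andP[_ h']; exfalso.
  by move: xm; rewrite eq_le h h'.
- move=> rx; split; first exact: rJ.
  by rewrite /= mE; have := grid_mem_le Dr rx; rewrite ri; lra.
- move=> [Jx /=]; rewrite mE => h; have [//|] := children_cover DJ Jx.
  by move=> /(grid_mem_le Dr); rewrite ri lr; lra.
- move=> lx; split; first exact: lJ.
  by rewrite /= mE lt_neqAle xm/=; have := grid_mem_le Dl lx; rewrite li ll; lra.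
Qed.

Lemma cell_child k x :
  cell D (k - 1) x = lchild (cell D k x) \/ cell D (k - 1) x = rchild (cell D k x).
Proof.
have E : (2 : R) ^ (k - 1) = 2 ^ k / 2 by rewrite expfzDr// exprN1.
have DJ := cell_grid hD k x.
have [Dl ll _ lJ] := lchildP DJ; have [Dr lr _ rJ] := rchildP DJ.
rewrite len_cell// -E in ll lr.
by have [h|h] := children_cover DJ (mem_cell hD k x); [left|right]; apply/esym/(cell_eq hD).
Qed.

Lemma cell_step k x : cell D (k - 1) x `<=` cell D k x /\
  len (cell D (k - 1) x) = len (cell D k x) / 2.
Proof.
split; first by apply: cell_subset => //; lia.
by rewrite !len_cell// expfzDr// exprN1.
Qed.

End children.
Arguments lchild {R} D J.
Arguments rchild {R} D J.

(** * Averages, Haar coefficients and differentiation along the grid *)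

Section almost_everywhere_lebesgue.
Context {R : realType}.
Local Notation mu := (@lebesgue_measure R).

Lemma ae_mono (P Q : R -> Prop) : {ae mu, forall x, P x} ->
  (forall x, P x -> Q x) -> {ae mu, forall x, Q x}.
Proof.
move=> aP PQ; apply: (@negligibleS _ _ _ mu _ _ _ aP) => x /= nQ Px.
by apply: nQ; exact: PQ.
Qed.

Lemma ae_outside (N : set R) (P : R -> Prop) : mu.-negligible N ->
  (forall x, ~ N x -> P x) -> {ae mu, forall x, P x}.
Proof.
move=> N0 NP; apply: (@negligibleS _ _ _ mu _ _ _ N0) => x /= nP.
by apply: contrapT => /NP.
Qed.

Lemma ae_and (P Q : R -> Prop) : {ae mu, forall x, P x} ->
  {ae mu, forall x, Q x} -> {ae mu, forall x, P x /\ Q x}.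
Proof.
move=> aP aQ; apply: (@negligibleS _ _ _ mu _ _ _ (negligibleU aP aQ)) => x /= nPQ.
by apply: contrapT => /not_orP[/contrapT Px /contrapT Qx]; apply: nPQ.
Qed.

Lemma ae_forall_nat (P : nat -> R -> Prop) :
  (forall n, {ae mu, forall x, P n x}) -> {ae mu, forall x, forall n, P n x}.
Proof.
move=> aP; apply: (@negligibleS _ _ _ mu _ _ _ (negligible_bigcup aP)) => x /= nP.
by apply: contrapT => h; apply: nP => n; apply: contrapT => nPx; apply: h; exists n.
Qed.

End almost_everywhere_lebesgue.

Section unit_interval_multipliers.
Context {R : realType}.
Implicit Types (J : set R) (h g : R -> R).
Local Notation mu := (@lebesgue_measure R).

Lemma unit_fun_bounded h J : (forall x, 0 <= h x <= 1) -> [bounded h x | x in J].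
Proof.
move=> h01; exists 1; split => // M M1 x _ /=; have /andP[h0 h1] := h01 x.
by rewrite ger0_norm// (le_trans h1)// ltW.
Qed.

Lemma unit_fun_mul_integrable h g J : measurable J -> measurable_fun setT h ->
  (forall x, 0 <= h x <= 1) -> mu.-integrable J (EFin \o g) ->
  mu.-integrable J (EFin \o (fun x => h x * g x)).
Proof.
move=> mJ mh h01 ig; apply: (@integrableMr _ _ _ mu J mJ h (EFin \o g)) => //.
  exact: measurable_funTS.
exact: unit_fun_bounded.
Qed.

End unit_interval_multipliers.

Section averages.
Context {R : realType} {D : set (set R)} (hD : dyadic_grid D).
Implicit Types (I J K : set R) (x y : R) (k : int) (f g h : R -> R).
Local Notation mu := (@lebesgue_measure R).

Lemma grid_integrable g J : locally_integrable setT g -> D J ->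
  mu.-integrable J (EFin \o g).
Proof.
move=> [mg _ ig] DJ; have [_ sJ _] := grid_bounds hD DJ.
have h : mu.-integrable `[inf J, sup J] (EFin \o g).
  apply/integrableP; split; first by apply/measurable_EFinP; exact: measurable_funTS.
  by apply: ig => //; exact: segment_compact.
have mI : measurable `[inf J, sup J] by exact: measurable_itv.
exact: (@integrableS _ _ _ mu _ _ _ mI (grid_measurable hD DJ) sJ h).
Qed.

Lemma unit_fun_integrable h J : measurable_fun setT h ->
  (forall x, 0 <= h x <= 1) -> D J -> mu.-integrable J (EFin \o h).
Proof.
move=> mh h01 DJ; have mJ := grid_measurable hD DJ.
have muJ : (mu J < +oo)%E by rewrite (grid_mu hD DJ) ltry.
apply: (@measurable_bounded_integrable _ _ _ mu h J mJ muJ).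
  exact: measurable_funTS.
exact: unit_fun_bounded.
Qed.

Lemma locally_integrable_norm g : locally_integrable setT g ->
  locally_integrable setT (fun x => `|g x|).
Proof.
move=> [mg oT ig]; split => //; first exact: measurableT_comp.
by move=> K KT cK; under eq_integral do rewrite normr_id; exact: ig.
Qed.

Lemma len_avg g J : D J -> len J * avg g J = Rintegral mu J g.
Proof. by move=> DJ; rewrite /avg mulrA mulfV ?mul1r// gt_eqF// (len_gt0 hD). Qed.

Lemma Rintegral_children g J : locally_integrable setT g -> D J ->
  Rintegral mu J g = Rintegral mu (lchild D J) g + Rintegral mu (rchild D J) g.
Proof.
move=> lg DJ; rewrite [in LHS](childrenU hD DJ) Rintegral_setU//.
- by apply: (grid_measurable hD); case: (lchildP hD DJ).
- by apply: (grid_measurable hD); case: (rchildP hD DJ).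
- by rewrite -childrenU//; exact: grid_integrable.
- by apply/disj_setPS => x [lx rx]; apply: (children_disj hD DJ lx rx).
Qed.

Lemma avg_children g J : locally_integrable setT g -> D J ->
  avg g J = (avg g (lchild D J) + avg g (rchild D J)) / 2.
Proof.
move=> lg DJ; have J0 := len_gt0 hD DJ.
have [Dl ll _ _] := lchildP hD DJ; have [Dr lr _ _] := rchildP hD DJ.
rewrite /avg Rintegral_children// ll lr; field.
by rewrite gt_eqF.
Qed.

Lemma ler_norm_avg g J : locally_integrable setT g -> D J ->
  `|avg g J| <= avg (fun x => `|g x|) J.
Proof.
move=> lg DJ; rewrite /avg normrM gtr0_norm ?invr_gt0 ?(len_gt0 hD)//.
rewrite ler_pM2l ?invr_gt0 ?(len_gt0 hD)//.
apply: le_normr_Rintegral; first exact: (grid_measurable hD DJ).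
exact: grid_integrable.
Qed.

Lemma avg_norm_ge0 g J : D J -> 0 <= avg (fun x => `|g x|) J.
Proof.
move=> DJ; rewrite /avg mulr_ge0 ?invr_ge0 ?(ltW (len_gt0 hD DJ))//.
exact: Rintegral_ge0.
Qed.

Lemma right_half_measurable J : D J -> measurable (right_half J).
Proof.
move=> DJ; apply: measurableI; first exact: (grid_measurable hD DJ).
have -> : [set x | midpoint J <= x] = [set` `[midpoint J, +oo[].
  by apply/seteqP; split=> x /=; rewrite in_itv/= andbT.
exact: measurable_itv.
Qed.

Lemma left_half_measurable J : D J -> measurable (left_half J).
Proof.
move=> DJ; apply: measurableI; first exact: (grid_measurable hD DJ).
have -> : [set x | x < midpoint J] = [set` `]-oo, midpoint J[].
  by apply/seteqP; split=> x /=; rewrite in_itv/=.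
exact: measurable_itv.
Qed.

Lemma measurable_haar J : D J -> measurable_fun setT (haar J).
Proof.
move=> DJ; apply: measurable_funM => //; apply: measurable_funB.
  by apply: measurable_indic; exact: right_half_measurable.
by apply: measurable_indic; exact: left_half_measurable.
Qed.

(** Off the midpoint the Haar function is a multiple of the difference of the
    indicators of the children, so its coefficients compare their averages. *)
Lemma inner_haar g J : locally_integrable setT g -> D J ->
  inner g (haar J) =
  Num.sqrt (len J) * ((avg g (rchild D J) - avg g (lchild D J)) / 2).
Proof.
move=> lg DJ; have J0 := len_gt0 hD DJ.
have [Dl ll _ _] := lchildP hD DJ; have [Dr lr _ _] := rchildP hD DJ.
have [mg _ _] := lg.
have ml := grid_measurable hD Dl; have mr := grid_measurable hD Dr.
pose s := (Num.sqrt (len J))^-1.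
have -> : inner g (haar J) = Rintegral mu setT
    (fun x => s * ((g \_ (rchild D J)) x - (g \_ (lchild D J)) x)).
  rewrite /inner /Rintegral; congr fine; apply: ae_eq_integral => //.
  - by apply/measurable_EFinP; apply: measurable_funM => //; exact: measurable_haar.
  - apply/measurable_EFinP; apply: measurable_funM => //; apply: measurable_funB.
      by apply/(measurable_restrictT _ _).1 => //; exact: measurable_funTS.
    by apply/(measurable_restrictT _ _).1 => //; exact: measurable_funTS.
  apply: (@negligibleS _ _ _ mu [set midpoint J]).
    move=> x /= /not_implyP[_ h]; apply: contrapT => /eqP xm; apply: h.
    rewrite (haarE hD)// !patchE !indicE -[point]/(0 : R); congr EFin; rewrite /s.
    by case: (x \in rchild D J); case: (x \in lchild D J) => /=; ring.
  by exists [set midpoint J]; split => //; exact: lebesgue_measure_set1.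
have ir : mu.-integrable setT (EFin \o (g \_ (rchild D J))).
  rewrite -restrict_EFin; apply/(integrable_mkcond _ _).1 => //.
  exact: grid_integrable.
have il : mu.-integrable setT (EFin \o (g \_ (lchild D J))).
  rewrite -restrict_EFin; apply/(integrable_mkcond _ _).1 => //.
  exact: grid_integrable.
rewrite RintegralZl//; last by apply: (integrableB _ ir il).
rewrite RintegralB// -!Rintegral_mkcond -!len_avg// ll lr /s.
have q0 : Num.sqrt (len J) != 0 by rewrite gt_eqF// sqrtr_gt0.
have := sqr_sqrtr (ltW J0); move: (Num.sqrt (len J)) q0 => q q0 <-.
by field.
Qed.

(** The ball around x of radius twice the length of the cell contains the cell
    and has four times its measure. *)
Lemma cell_nicely_shrinking x : nicely_shrinking x (fun n => cell D (- n%:Z) x).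
Proof.
split=> [n|]; first exact: (grid_measurable hD (cell_grid hD _ _)).
have r0 n : 0 < (2 : R) * 2^-1 ^+ n by rewrite mulr_gt0// exprn_gt0.
exists (4, fun n => PosNum (r0 n)); split => //=.
- rewrite -[0](mulr0 2); apply: cvgM; first exact: cvg_cst.
  by apply: cvg_expr; rewrite gtr0_norm// invf_lt1// ltr1n.
- move=> n y yx; rewrite /ball/= /ball_; apply: (@le_lt_trans _ _ (2 ^ (- n%:Z))).
    have [_ sJ JJ] := grid_bounds hD (cell_grid hD (- n%:Z) x).
    have := sJ _ yx; have := sJ _ (mem_cell hD _ x).
    rewrite /= !in_itv/= => /andP[a b] /andP[c d]; rewrite len_cell// in JJ.
    by rewrite ler_norml; apply/andP; split; lra.
  have -> : (2 : R) ^ (- n%:Z) = 2^-1 ^+ n by rewrite exprVn -exprnN.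
  by have := r0 n; lra.
- move=> n; rewrite lebesgue_measure_ball ?(ltW (r0 n))//.
  rewrite (grid_mu hD (cell_grid hD _ _)) len_cell//.
  have -> : (2 : R) ^ (- n%:Z) = 2^-1 ^+ n by rewrite exprVn -exprnN.
  by rewrite -EFinM lee_fin -mulr_natl; lra.
Qed.

Lemma avg_cvg g : locally_integrable setT g ->
  {ae mu, forall x, avg g (cell D (- n%:Z) x) @[n --> \oo] --> g x}.
Proof.
move=> lg; apply: (ae_mono (lebesgue_differentiation lg)) => x gx.
have := nice_lebesgue_differentiation cell_nicely_shrinking lg gx.
move=> /fine_cvgP[_]; apply: cvg_trans; apply: near_eq_cvg; apply: nearW => n /=.
have Dc := cell_grid hD (- n%:Z) x.
rewrite (grid_mu hD Dc) inver gt_eqF ?(len_gt0 hD)// /avg /Rintegral.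
rewrite fineM//; apply: integrable_fin_num.
  exact: (grid_measurable hD Dc).
exact: grid_integrable.
Qed.

(** The value at x of the martingale difference of g on the cell of x. *)
Definition avg_incr g k x := avg g (cell D (k - 1) x) - avg g (cell D k x).

Lemma haar_cell k x : x != midpoint (cell D k x) ->
  haar (cell D k x) x = (Num.sqrt (len (cell D k x)))^-1 *
    (if `[< cell D (k - 1) x = rchild D (cell D k x) >] then 1 else -1).
Proof.
move=> xm; have DJ := cell_grid hD k x; rewrite (haarE hD)// !indicE.
case: asboolP => [h|nh]; have xc := mem_cell hD (k - 1) x.
  rewrite h in xc; rewrite mem_set// memNset ?subr0//.
  by move=> lx; exact: (children_disj hD DJ lx xc).
have [h|//] := cell_child hD k x; rewrite h in xc.
rewrite memNset ?mem_set//= ?sub0r//.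
by move=> rx; exact: (children_disj hD DJ xc rx).
Qed.

Lemma inner_haar_mul g k x : locally_integrable setT g ->
  x != midpoint (cell D k x) ->
  inner g (haar (cell D k x)) * haar (cell D k x) x = avg_incr g k x.
Proof.
move=> lg xm; have DJ := cell_grid hD k x.
have q0 : Num.sqrt (len (cell D k x)) != 0.
  by rewrite gt_eqF// sqrtr_gt0 (len_gt0 hD).
rewrite inner_haar// haar_cell// /avg_incr (avg_children lg DJ).
case: asboolP => [->|nh]; first by field.
by have [->|//] := cell_child hD k x; field.
Qed.

Lemma haar_sqr k x : x != midpoint (cell D k x) ->
  haar (cell D k x) x * haar (cell D k x) x = 1 / len (cell D k x).
Proof.
move=> xm; have J0 := len_gt0 hD (cell_grid hD k x).
have q0 : Num.sqrt (len (cell D k x)) != 0 by rewrite gt_eqF// sqrtr_gt0.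
rewrite haar_cell// -[in RHS](sqr_sqrtr (ltW J0)).
by case: asboolP => _; field.
Qed.

Lemma haar_out J y : ~ J y -> haar J y = 0.
Proof.
by move=> nJ; rewrite /haar !indicE !memNset ?subrr ?mulr0// => -[Jy _]; exact: nJ.
Qed.

Lemma ae_not_midpoint :
  {ae mu, forall x, forall k, x != midpoint (cell D k x)}.
Proof.
have N : mu.-negligible (midpoint @` D).
  have cN : countable (midpoint @` D).
    exact: (card_le_trans (card_image_le _ _) (grid_countable hD)).
  have mN : measurable (midpoint @` D) by exact: countable_measurable.
  exists (midpoint @` D); split => //.
  exact: countable_lebesgue_measure0.
apply: (ae_outside N) => x Nx k; apply/eqP => xm; apply: Nx.
by exists (cell D k x) => //; exact: cell_grid.
Qed.

End averages.
Arguments avg_incr {R} D g k x.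

(** * Almost everywhere convergence of dyadic martingale transforms *)

Section martingale_transform.
Context {R : realType} {D : set (set R)} (hD : dyadic_grid D).
Implicit Types (I J K : set R) (x y s : R) (k : int) (m n i : nat).
Local Notation mu := (@lebesgue_measure R).
Local Notation l := (lchild D).
Local Notation r := (rchild D).

Section stopped_tree.
Variables (a : set R -> bool) (u : set R -> R) (e : R).
Hypothesis e0 : 0 < e.

(** The integral over J of the first n squared increments of a walk that moves
    by [u K] in the right child of K, by [- u K] in the left child, and stops at
    the first interval where [a] fails. Like the two sets below it is built by
    recursion on the children, so that measurability and the maximal inequality
    are inductions on n. *)
Fixpoint energy n J : R := if n is n'.+1 then
  if a J then u J ^+ 2 * len J + energy n' (l J) + energy n' (r J) else 0
  else 0.

(** The points at which the stopped walk, started at s in J, exceeds e in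
    absolute value within n steps. *)
Fixpoint exceed n s J : set R := if e < `|s| then J else
  if n is n'.+1 then
    if a J then exceed n' (s - u J) (l J) `|` exceed n' (s + u J) (r J)
    else set0
  else set0.

(** The points at which the stopped walk moves by more than e in n steps after its
    first m. *)
Fixpoint exceed_from m n J : set R := if m is m'.+1 then
  if a J then exceed_from m' n (l J) `|` exceed_from m' n (r J) else set0
  else exceed n 0 J.

Lemma energy_ge0 n J : D J -> 0 <= energy n J.
Proof.
elim: n J => //= n IH J DJ; case: ifP => // _.
have [Dl _ _ _] := lchildP hD DJ; have [Dr _ _ _] := rchildP hD DJ.
by rewrite !addr_ge0 ?IH// mulr_ge0 ?sqr_ge0// (ltW (len_gt0 hD DJ)).
Qed.

Lemma exceed_measurable n s J : D J -> measurable (exceed n s J).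
Proof.
elim: n s J => [|n IH] s J DJ /=; first by case: ifP => // _; exact: (grid_measurable hD).
have [Dl _ _ _] := lchildP hD DJ; have [Dr _ _ _] := rchildP hD DJ.
case: ifP => _; first exact: (grid_measurable hD).
by case: ifP => // _; apply: measurableU; exact: IH.
Qed.

Lemma exceed_from_measurable m n J : D J -> measurable (exceed_from m n J).
Proof.
elim: m J => [|m IH] J DJ /=; first exact: exceed_measurable.
have [Dl _ _ _] := lchildP hD DJ; have [Dr _ _ _] := rchildP hD DJ.
by case: ifP => // _; apply: measurableU; exact: IH.
Qed.

Lemma exceed_mono n n' s J : (n <= n')%N -> exceed n s J `<=` exceed n' s J.
Proof.
elim: n n' s J => [|n IH] [|n'] s J //= nn'; case: (e < _); try exact: subset_refl.
  exact: sub0set.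
by case: (a J) => //; apply: setUSS; exact: IH.
Qed.

Lemma exceed_from_mono m n n' J : (n <= n')%N ->
  exceed_from m n J `<=` exceed_from m n' J.
Proof.
move=> nn'; elim: m J => [|m IH] J /=; first exact: exceed_mono.
by case: (a J) => //; apply: setUSS; exact: IH.
Qed.

(** Kolmogorov's maximal inequality. The quantity s ^ 2 |J| + energy survives a
    step unchanged, because the squares of s + u and s - u average to s ^ 2 + u ^ 2;
    once the walk exceeds e it is at least e ^ 2 |J|. *)
Lemma exceed_mu n s J : D J ->
  (mu (exceed n s J) <= ((s ^+ 2 * len J + energy n J) / e ^+ 2)%:E)%E.
Proof.
move=> DJ.
have stop s' J' n' : D J' -> e < `|s'| ->
    (mu J' <= ((s' ^+ 2 * len J' + energy n' J') / e ^+ 2)%:E)%E.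
  move=> DJ' es; rewrite (grid_mu hD DJ') lee_fin ler_pdivlMr ?exprn_gt0//.
  have J0 := len_gt0 hD DJ'; have := energy_ge0 n' DJ'.
  have : e ^+ 2 <= s' ^+ 2.
    by rewrite -(real_normK (num_real s')) ler_pXn2r// ?nnegrE// ?ltW.
  by move=> ? ?; rewrite -[leLHS]addr0 lerD// mulrC ler_pM2r.
elim: n s J DJ => [|n IH] s J DJ /=.
  case: ifP => [es|_]; first exact: (stop _ _ 0%N).
  rewrite measure0 lee_fin divr_ge0 ?exprn_ge0 ?(ltW e0)// addr0.
  by rewrite mulr_ge0 ?sqr_ge0// (ltW (len_gt0 hD DJ)).
have [Dl ll _ _] := lchildP hD DJ; have [Dr lr _ _] := rchildP hD DJ.
case: ifPn => [es|_]; first exact: (stop _ _ n.+1).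
case: ifPn => aJ; last first.
  rewrite measure0 lee_fin divr_ge0 ?exprn_ge0 ?(ltW e0)// addr0.
  by rewrite mulr_ge0 ?sqr_ge0// (ltW (len_gt0 hD DJ)).
have mU := @measureU2 _ _ _ mu _ _
  (exceed_measurable n (s - u J) Dl)
  (exceed_measurable n (s + u J) Dr).
apply: (le_trans mU); apply: (le_trans (leeD (IH _ _ Dl) (IH _ _ Dr))).
rewrite -EFinD lee_fin -mulrDl ler_pM2r ?invr_gt0 ?exprn_gt0// ll lr le_eqVlt.
by apply/orP; left; apply/eqP; field.
Qed.

Lemma exceed_from_mu m n J : D J ->
  (mu (exceed_from m n J) <= ((energy (m + n) J - energy m J) / e ^+ 2)%:E)%E.
Proof.
elim: m J => [|m IH] J DJ /=.
  by apply: (le_trans (exceed_mu n 0 DJ)); rewrite expr0n/= mul0r add0r subr0 add0n.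
have [Dl ll _ _] := lchildP hD DJ; have [Dr lr _ _] := rchildP hD DJ.
case: ifPn => aJ; last by rewrite measure0 subrr mul0r.
have mU := @measureU2 _ _ _ mu _ _
  (exceed_from_measurable m n Dl)
  (exceed_from_measurable m n Dr).
apply: (le_trans mU); apply: (le_trans (leeD (IH _ Dl) (IH _ Dr))).
rewrite -EFinD lee_fin -mulrDl ler_pM2r ?invr_gt0 ?exprn_gt0// le_eqVlt.
by apply/orP; left; apply/eqP; ring.
Qed.

(** Bounded energies converge, so the energy after generation m tends to 0 with m,
    and with it the chance of an oscillation larger than e. *)
Lemma limsup_exceed_negligible J C : D J -> (forall n, energy n J <= C) ->
  mu.-negligible (\bigcap_m \bigcup_n exceed_from m n J).
Proof.
move=> DJ EC.
have mU m : measurable (\bigcup_n exceed_from m n J).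
  by apply: bigcupT_measurable => n; exact: exceed_from_measurable.
exists (\bigcap_m \bigcup_n exceed_from m n J); split=> //.
  exact: bigcapT_measurable.
pose E := sup (range (fun n => energy n J)).
have hE : has_sup (range (fun n => energy n J)).
  by split; [exists (energy 0 J); exists 0%N|exists C => _ [n _ <-]].
have leE n : energy n J <= E by apply: ub_le_sup; [case: hE|exists n].
have muU m :
    (mu (\bigcup_n exceed_from m n J) <= ((E - energy m J) / e ^+ 2)%:E)%E.
  have F n : measurable (exceed_from m n J) by exact: exceed_from_measurable.
  have ndF : nondecreasing_seq (fun n => exceed_from m n J).
    by apply/nondecreasing_seqP => n; apply/subsetPset; exact: exceed_from_mono.
  have cv := @nondecreasing_cvg_mu _ _ _ mu _ F (mU m) ndF.
  rewrite -(cvg_lim _ cv)//; apply: lime_le; first by apply/cvg_ex; eexists; exact: cv.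
  apply: nearW => n /=; apply: (le_trans (exceed_from_mu m n DJ)).
  by rewrite lee_fin ler_pM2r ?invr_gt0 ?exprn_gt0// lerD2r.
apply/eqP; rewrite -measure_le0; apply/lee_addgt0Pr => d d0; rewrite add0e.
have ed0 : 0 < d * e ^+ 2 by rewrite mulr_gt0// exprn_gt0.
have [_ [m _ <-] mE] := sup_adherent ed0 hE.
apply: (@le_trans _ _ (mu (\bigcup_n exceed_from m n J))).
  by apply: le_measure; [rewrite inE; exact: bigcapT_measurable|
    rewrite inE; exact: mU|exact: bigcap_inf].
apply: (le_trans (muU m)); rewrite lee_fin ler_pdivrMr ?exprn_gt0//.
by rewrite -/E in mE; lra.
Qed.

Variables (x : R) (xi : int -> R).
Hypothesis xiE : forall k,
  xi k = u (cell D k x) /\ cell D (k - 1) x = r (cell D k x) \/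
  xi k = - u (cell D k x) /\ cell D (k - 1) x = l (cell D k x).

Lemma mem_exceed n i s k : (forall j : nat, a (cell D (k - j%:Z) x)) ->
  (i <= n)%N ->
  e < `|s + \sum_(0 <= j < i) xi (k - j%:Z)| -> exceed n s (cell D k x) x.
Proof.
elim: n i s k => [|n IH] i s k al.
  rewrite leqn0 => /eqP ->; rewrite big_geq// addr0 /= => ->; exact: mem_cell.
case: i => [_|i]; first by rewrite big_geq// addr0 /= => ->; exact: mem_cell.
rewrite ltnS => ni; rewrite big_nat_recl// subr0.
under eq_bigr do rewrite -addn1 PoszD opprD addrA addrAC.
rewrite addrA => h /=; case: ifP => _; first exact: mem_cell.
have := al 0%N; rewrite subr0 => ->.
have al' (j : nat) : a (cell D (k - 1 - j%:Z) x).
  by have := al j.+1; rewrite -addn1 PoszD opprD addrA addrAC.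
by case: (xiE k) h => -[-> <-] h; [right|left]; exact: (IH i).
Qed.

Lemma mem_exceed_from m n i k : (forall j : nat, a (cell D (k - j%:Z) x)) ->
  (i <= n)%N -> e < `|\sum_(0 <= j < i) xi (k - (m + j)%N%:Z)| ->
  exceed_from m n (cell D k x) x.
Proof.
elim: m k => [|m IH] k al ni /= h.
  by apply: (@mem_exceed _ i) => //; rewrite add0r.
have := al 0%N; rewrite subr0 => ->.
have al' (j : nat) : a (cell D (k - 1 - j%:Z) x).
  by have := al j.+1; rewrite -addn1 PoszD opprD addrA addrAC.
have {}IH := IH _ al' ni.
case: (xiE k) => -[_ E]; rewrite -E; [right|left]; apply: IH;
  by move: h; under eq_bigr do rewrite addSn -addn1 PoszD opprD addrA addrAC.
Qed.

End stopped_tree.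

Variables (g : R -> R) (v : set R -> R).
Hypothesis lg : locally_integrable setT g.
Local Notation ag := (avg (fun y => `|g y|)).

Let transform_incr k x := v (cell D k x) * avg_incr D g k x.

Let u J := v J * ((avg g (r J) - avg g (l J)) / 2).

Let transform_incrE x k :
  transform_incr k x = u (cell D k x) /\ cell D (k - 1) x = r (cell D k x) \/
  transform_incr k x = - u (cell D k x) /\ cell D (k - 1) x = l (cell D k x).
Proof.
have E := avg_children hD lg (cell_grid hD k x).
by have [h|h] := cell_child hD k x; [right|left];
  rewrite /transform_incr /avg_incr h /u; split => //; rewrite E; field.
Qed.

Let alive (la : R) J := (`|v J| <= la) && (ag J <= la).

(** By the parallelogram law the bound at J exceeds the sum of the bounds at its
    children by la ^ 2 |J| times the squared increment of g, which pays for the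
    term of J in the energy. The walk stops one step late: where |g| averages at
    most la, it averages at most 2 la over each child, and this is the bound on
    the averages of g that the walk meets. *)
Lemma energy_bounded (la : R) n J : D J -> `|avg g J| <= 2 * la ->
  energy (alive la) u n J <= la ^+ 2 * (4 * la ^+ 2 - avg g J ^+ 2) * len J.
Proof.
have pos J' : D J' -> `|avg g J'| <= 2 * la ->
    0 <= la ^+ 2 * (4 * la ^+ 2 - avg g J' ^+ 2) * len J'.
  move=> DJ' h; apply: mulr_ge0; last exact: (ltW (len_gt0 hD DJ')).
  apply: mulr_ge0; first exact: sqr_ge0.
  rewrite subr_ge0.
  rewrite -(real_normK (num_real (avg g J'))).
  rewrite (_ : 4 * la ^+ 2 = (2 * la) ^+ 2); last by ring.
  by rewrite ler_pXn2r// nnegrE// (le_trans _ h).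
elim: n J => [|n IH] J DJ h /=; first exact: pos.
case: ifPn => [/andP[vJ aJ]|_]; last exact: pos.
have [Dl ll _ _] := lchildP hD DJ; have [Dr lr _ _] := rchildP hD DJ.
have E := avg_children hD lg DJ.
have E' := avg_children hD (locally_integrable_norm lg) DJ.
have al0 := avg_norm_ge0 hD g Dl; have ar0 := avg_norm_ge0 hD g Dr.
have hl : `|avg g (l J)| <= 2 * la by apply: (le_trans (ler_norm_avg hD lg Dl)); lra.
have hr : `|avg g (r J)| <= 2 * la by apply: (le_trans (ler_norm_avg hD lg Dr)); lra.
have v2 : v J ^+ 2 <= la ^+ 2.
  by rewrite -(real_normK (num_real (v J))) ler_pXn2r// nnegrE// (le_trans _ vJ).
have d0 : 0 <= ((avg g (r J) - avg g (l J)) / 2) ^+ 2 * len J.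
  by rewrite mulr_ge0 ?sqr_ge0// (ltW (len_gt0 hD DJ)).
have key := lerD (ler_wpM2r d0 v2) (lerD (IH _ Dl hl) (IH _ Dr hr)).
apply: (le_trans _ (le_trans key _)); rewrite le_eqVlt;
  apply/orP; left; apply/eqP.
  by rewrite {1}/u; ring.
by rewrite ll lr E; field.
Qed.

Lemma energy_bound (la : R) J : D J ->
  exists C, forall n, energy (alive la) u n J <= C.
Proof.
move=> DJ; have [aJ|aJ] := boolP (alive la J); last first.
  by exists 0 => -[|n] //=; rewrite (negbTE aJ).
exists (la ^+ 2 * (4 * la ^+ 2 - avg g J ^+ 2) * len J) => n.
apply: energy_bounded => //; have := ler_norm_avg hD lg DJ.
by have := avg_norm_ge0 hD g DJ; case/andP: aJ; lra.
Qed.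

(** Burkholder's theorem for the dyadic filtration. For almost every x the bounds
    hold with some integer la, so the walk stopped at intervals that exceed la
    never stops at x, and its energy is bounded. There are countably many choices
    of la, of a precision and of a unit cell, and for each of them the points of
    persistent oscillation are negligible; elsewhere the sums are Cauchy. *)
Lemma transform_cvg :
  {ae mu, forall x, exists M : R, forall n : nat,
    `|v (cell D (- n%:Z) x)| <= M /\ ag (cell D (- n%:Z) x) <= M} ->
  {ae mu, forall x, cvgn (fun n => \sum_(0 <= j < n)
    (v (cell D (- j%:Z) x) * avg_incr D g (- j%:Z) x))}.
Proof.
move=> bdd.
pose N (la q : nat) (z : int) := \bigcap_m \bigcup_n
  exceed_from (alive la%:R) u (q.+1%:R^-1) m n (cell D 0 (z%:~R / 2)).
have N0 : {ae mu, forall x, forall la q z, ~ N la q z x}.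
  apply: (@ae_mono _ (fun x => forall n,
    if unpickle n is Some t then ~ N t.1.1 t.1.2 t.2 x else True)).
    apply: ae_forall_nat => n; case: unpickle => [[[la q] z]|] /=.
      have [C EC] := energy_bound la%:R (cell_grid hD 0 (z%:~R / 2)).
      apply: (@ae_outside _ (N la q z)) => //.
      by apply: limsup_exceed_negligible EC => //; exact: cell_grid.
    by apply: (@ae_outside _ set0) => //; exact: negligible_set0.
  by move=> x h la q z; have := h (pickle (la, q, z)); rewrite pickleK.
apply: (ae_mono (ae_and bdd N0)) => x [[M bM] Nx].
have [z _ zx] := unit_cells_cover hD (Logic.I : setT x).
pose la := (Num.truncn `|M|).+1.
have Mla : M <= la%:R by rewrite (le_trans (ler_norm _))// ltW// truncnS_gt.
have al (j : nat) : alive la%:R (cell D (0 - j%:Z) x).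
  by rewrite sub0r /alive; have [a b] := bM j; rewrite (le_trans a)// (le_trans b).
apply: cauchy_cvg; apply: cauchy_exP => e e0.
pose q := Num.truncn e^-1.
have qe : q.+1%:R^-1 < e by rewrite invf_plt ?posrE// truncnS_gt.
have [m mx] : exists m, forall n,
    ~ exceed_from (alive la%:R) u (q.+1%:R^-1) m n (cell D 0 (z%:~R / 2)) x.
  apply: contrapT => h; apply: (Nx la q z) => m _; apply: contrapT => h'.
  by apply: h; exists m => n ?; apply: h'; exists n.
exists (\sum_(0 <= j < m) transform_incr (- j%:Z) x); exists m => // n /= mn.
rewrite /ball/= /ball_/= distrC (big_cat_nat _ mn)//= addrAC subrr add0r.
apply: (le_lt_trans _ qe); rewrite leNgt; apply/negP => h.
apply: (mx (n - m)%N); rewrite -(eq_cell hD zx).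
apply: (@mem_exceed_from _ _ _ _ (fun k => transform_incr k x)
  (transform_incrE x) _ _ (n - m)) => //.
move: h; rewrite -{1}[m]add0n big_addn.
by under eq_bigr do rewrite -sub0r addnC.
Qed.

End martingale_transform.

(** * Weights *)

Section weighted_hoelder.
Context {R : realType} (w : R -> R) (p : R).
Implicit Types (J : set R) (phi : R -> R).
Hypotheses (p1 : 1 < p) (mw : measurable_fun setT w).
Local Notation mu := (@lebesgue_measure R).
Hypothesis w0 : {ae mu, forall x, 0 < w x}.

Let P : set R := [set x | 0 < w x].

Let mP : measurable P.
Proof.
have -> : P = w @^-1` [set` `]0, +oo[].
  by apply/seteqP; split => x; rewrite /P/= in_itv/= andbT.
by rewrite -[_ @^-1` _]setTI; apply: mw => //; exact: measurable_itv.
Qed.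

Let muP : mu (~` P) = 0.
Proof. by apply: measure_negligible => //; exact: measurableC. Qed.

Let conj_gt0 : 0 < conj_exp p.
Proof. by rewrite /conj_exp invr_gt0 subr_gt0 invf_lt1// (lt_trans _ p1). Qed.

Let p0 : 0 < p. Proof. exact: lt_trans p1. Qed.

Let conjE : p / conj_exp p = p - 1.
Proof. by rewrite /conj_exp invrK mulrBr mulr1 divff// gt_eqF. Qed.

(** Hölder's inequality for phi = (phi w ^ (1/p)) w ^ (-1/p), as phi ^ p <= phi
    and w ^ (-p'/p) is the dual weight. For phi the indicator of a subset of J
    this is the usual comparison of the two sets. *)
Lemma weighted_hoelder phi J : measurable J -> mu.-integrable J (EFin \o w) ->
  measurable_fun setT phi ->
  (forall x, 0 <= phi x <= 1) ->
  ((\int[mu]_(x in J) (phi x)%:E) `^ p <=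
   \int[mu]_(x in J) (phi x * w x)%:E *
     (wmass (dual_weight p w) J) `^ (p - 1))%E.
Proof.
move=> mJ iw mphi phi01.
(* Off Q the weight may vanish or be negative, where its powers mean nothing. *)
pose Q := J `&` P.
have mQ : measurable Q by exact: measurableI.
pose F := (fun x => phi x * w x `^ p^-1) \_ Q.
pose G := (fun x => w x `^ (- p^-1)) \_ Q.
have mF : measurable_fun setT F.
  apply/(measurable_restrictT _ _).1 => //; apply: measurable_funTS.
  by apply: measurable_funM => //; exact: (measurableT_comp (measurable_powR _) mw).
have mG : measurable_fun setT G.
  apply/(measurable_restrictT _ _).1 => //; apply: measurable_funTS.
  by exact: (measurableT_comp (measurable_powR _) mw).
have pq : p^-1 + (conj_exp p)^-1 = 1 by rewrite /conj_exp invrK; lra.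
have := hoelder mu mF mG p0 conj_gt0 pq.
rewrite Lnorm1.
have -> : (\int[mu]_x `|(EFin \o (F \* G)%R) x| = \int[mu]_(x in J) (phi x)%:E)%E.
  rewrite [RHS](@ge0_negligible_integral _ _ _ mu _ _ _
    (measurableC mP) mJ _ _ muP); last 2 first.
  - by apply/measurable_EFinP; exact: measurable_funTS.
  - by move=> x _; rewrite lee_fin; case/andP: (phi01 x).
  rewrite setDE setCK [RHS]integral_mkcond; apply: eq_integral => x _ /=.
  rewrite /F /G !patchE -/Q -[point]/(0 : R).
  case: ifPn; last by rewrite mul0r normr0.
  rewrite inE => -[_ wx]; rewrite -mulrA -powRD; last first.
    by rewrite (gt_eqF (wx : 0 < w x)) implybT.
  by rewrite subrr powRr0 mulr1 ger0_norm//; case/andP: (phi01 x).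
move=> H.
have NF : ('N[mu]_p%:E[EFin \o F] `^ p <= \int[mu]_(x in J) (phi x * w x)%:E)%E.
  rewrite poweR_Lnorm ?gt_eqF//.
  apply: (@le_trans _ _ (\int[mu]_(x in Q) (phi x * w x)%:E)%E).
    rewrite [leRHS]integral_mkcond; apply: ge0_le_integral => //.
    - by move=> x _; exact: poweR_ge0.
    - have : measurable_fun setT (EFin \o (fun x => `|F x| `^ p)); last exact.
      apply/measurable_EFinP; apply: (measurableT_comp (measurable_powR _)).
      exact: measurableT_comp.
    - apply/(measurable_restrictT _ _).1 => //; apply: measurable_funTS.
      by apply/measurable_EFinP; exact: measurable_funM.
    move=> x _; rewrite /= /F !patchE /=; case: ifPn => [|_]; last first.
      by rewrite -[point]/(0 : R) -[point]/(0%E : \bar R) normr0 powR0// gt_eqF.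
    rewrite inE => -[_ /ltW wx]; have /andP[f0 f1] := phi01 x.
    rewrite ger0_norm ?mulr_ge0 ?powR_ge0// lee_fin powRM ?powR_ge0// -powRrM.
    rewrite mulVf ?gt_eqF// powRr1// ler_wpM2r//.
    have [->|fn0] := eqVneq (phi x) 0; first by rewrite powR0// gt_eqF.
    by rewrite ge1r_powR ?(ltW p1)// lt_neqAle eq_sym fn0 f0.
  have iphiw := unit_fun_mul_integrable mJ mphi phi01 iw.
  rewrite [leRHS](@negligible_integral _ _ _ mu _ _ _
    (measurableC mP) mJ iphiw muP).
  by rewrite setDE setCK.
have NG : ('N[mu]_(conj_exp p)%:E[EFin \o G] `^ conj_exp p <=
    wmass (dual_weight p w) J)%E.
  rewrite poweR_Lnorm ?gt_eqF// /wmass [leRHS]integral_mkcond.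
  apply: ge0_le_integral => //.
  - by move=> x _; exact: poweR_ge0.
  - have : measurable_fun setT (EFin \o (fun x => `|G x| `^ conj_exp p));
      last exact.
    apply/measurable_EFinP; apply: (measurableT_comp (measurable_powR _)).
    exact: measurableT_comp.
  - apply/(measurable_restrictT _ _).1 => //; apply: measurable_funTS.
    by apply/measurable_EFinP; exact: (measurableT_comp (measurable_powR _) mw).
  move=> x _; rewrite /= /G !patchE /=; case: ifPn => [|_]; last first.
    rewrite -[point]/(0 : R) -[point]/(0%E : \bar R) normr0 powR0 ?gt_eqF//.
    by case: ifP => // _; rewrite lee_fin powR_ge0.
  rewrite inE => -[Jx _]; rewrite mem_set//= ger0_norm ?powR_ge0//.
  rewrite -powRrM /dual_weight.
  have E : conj_exp p * (1 - p^-1) = 1.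
    by rewrite /conj_exp mulVf// gt_eqF// subr_gt0 invf_lt1// (lt_trans _ p1).
  by rewrite (_ : - p^-1 * conj_exp p = 1 - conj_exp p)// -[in RHS]E; ring.
have p00 : 0 <= p by exact: ltW.
apply: (le_trans (gt0_ler_poweR p00 _ _ H)).
- rewrite in_itv/= integral_ge0 ?leey// => x _.
  by rewrite lee_fin; case/andP: (phi01 x).
- by rewrite in_itv/= leey andbT mule_ge0// Lnorm_ge0.
rewrite poweRM ?Lnorm_ge0//; apply: lee_pmul => //; try exact: poweR_ge0.
have pE : conj_exp p * (p - 1) = p.
  by rewrite -conjE mulrCA mulfV ?mulr1// gt_eqF.
rewrite -[X in (_ `^ X <= _)%E]pE poweRrM; apply: gt0_ler_poweR => //.
- by rewrite subr_ge0 ltW.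
- by rewrite in_itv/= leey poweR_ge0.
- by rewrite in_itv/= leey integral_ge0// => x _; rewrite lee_fin powR_ge0.
Qed.
End weighted_hoelder.

Section Ap_weights.
Context {R : realType} {D : set (set R)} (hD : dyadic_grid D).
Variables (w : R -> R) (p : R).
Implicit Types (I J K : set R) (x y : R) (phi : R -> R).
Hypotheses (p1 : 1 < p) (hw : Ap D p w).
Local Notation mu := (@lebesgue_measure R).

Let lw : locally_integrable setT w. Proof. by case: hw => -[]. Qed.
Let mw : measurable_fun setT w. Proof. by case: lw. Qed.
Let w0 : {ae mu, forall x, 0 < w x}. Proof. by case: hw => -[]. Qed.

Lemma wmassE J : D J -> wmass w J = (Rintegral mu J w)%:E.
Proof.
move=> DJ; rewrite /wmass /Rintegral fineK//; apply: integrable_fin_num.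
  exact: (grid_measurable hD DJ).
exact: (grid_integrable hD).
Qed.

Lemma eavgE J : D J -> eavg w J = (avg w J)%:E.
Proof. by move=> DJ; rewrite /eavg wmassE// -EFinM. Qed.

(** The weight may be negative on a null set; with its absolute value the
    integrands become monotone in phi at every point. *)
Lemma ae_weight_norm phi J : D J -> measurable_fun setT phi ->
  Rintegral mu J (fun x => phi x * w x) = Rintegral mu J (fun x => phi x * `|w x|).
Proof.
move=> DJ mphi; congr fine; apply: ae_eq_integral.
- exact: (grid_measurable hD DJ).
- by apply/measurable_EFinP; apply: measurable_funTS; exact: measurable_funM.
- apply/measurable_EFinP; apply: measurable_funTS; apply: measurable_funM => //.
  exact: measurableT_comp.
by apply: (ae_mono w0) => x wx _; rewrite ger0_norm// ltW.
Qed.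

Lemma Rintegral_weight_norm J : D J ->
  Rintegral mu J w = Rintegral mu J (fun x => `|w x|).
Proof.
move=> DJ; transitivity (Rintegral mu J (fun x => cst 1 x * w x)).
  by apply: eq_Rintegral => x _; rewrite mul1r.
rewrite ae_weight_norm//; first by apply: eq_Rintegral => x _; rewrite mul1r.
Qed.

Lemma Rintegral_weight_ge0 J : D J -> 0 <= Rintegral mu J w.
Proof. by move=> DJ; rewrite Rintegral_weight_norm//; exact: Rintegral_ge0. Qed.

Lemma avg_weight_ge0 J : D J -> 0 <= avg w J.
Proof.
move=> DJ; rewrite /avg mulr_ge0 ?Rintegral_weight_ge0//.
by rewrite invr_ge0 ltW// (len_gt0 hD).
Qed.

Lemma Rintegral_weight_sub J K : D J -> D K -> K `<=` J ->
  Rintegral mu K w <= Rintegral mu J w.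
Proof.
move=> DJ DK KJ; rewrite !Rintegral_weight_norm//.
have lnw := locally_integrable_norm lw.
have mJ := grid_measurable hD DJ; have mK := grid_measurable hD DK.
apply: fine_le;
  try by apply: integrable_fin_num => //; exact: (grid_integrable hD lnw).
apply: ge0_subset_integral => //.
by apply/measurable_EFinP; apply: measurable_funTS; case: lnw.
Qed.

Lemma avg_weight_child J K : D J -> D K -> K `<=` J -> len K = len J / 2 ->
  avg w K <= 2 * avg w J.
Proof.
move=> DJ DK KJ lK; have J0 := len_gt0 hD DJ; rewrite /avg lK.
have := Rintegral_weight_sub DJ DK KJ; rewrite invf_div -mulrA ler_pM2l ?ltr0n//.
by rewrite ler_pM2l ?invr_gt0.
Qed.

Lemma Ap_const_ge0e : (0 <= Ap_const D p w)%E.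
Proof.
have DJ := cell_grid hD 0 0.
apply: (@le_trans _ _ (eavg w (cell D 0 0) *
    (eavg (dual_weight p w) (cell D 0 0)) `^ (p - 1))%E).
  by rewrite mule_ge0 ?poweR_ge0// eavgE// lee_fin avg_weight_ge0.
by apply: ereal_sup_ubound; exists (cell D 0 0).
Qed.

Lemma Ap_const_fin : Ap_const D p w \is a fin_num.
Proof. by case: hw => _ Afin; rewrite ge0_fin_numE// Ap_const_ge0e. Qed.

Local Notation A := (fine (Ap_const D p w)).

Lemma Ap_const_ge0 : 0 <= A.
Proof. exact: fine_ge0 Ap_const_ge0e. Qed.

(** Multiply the weighted Hölder inequality by w(J) and use the definition of the
    constant on J. *)
Lemma Ap_testing phi J : D J -> measurable_fun setT phi ->
  (forall x, 0 <= phi x <= 1) ->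
  Rintegral mu J w * (Rintegral mu J phi) `^ p <=
  A * len J `^ p * Rintegral mu J (fun x => phi x * `|w x|).
Proof.
move=> DJ mphi phi01; have J0 := len_gt0 hD DJ; have mJ := grid_measurable hD DJ.
have iw := grid_integrable hD lw DJ.
have iphi := unit_fun_integrable hD mphi phi01 DJ.
have iphiw := unit_fun_mul_integrable mJ mphi phi01 iw.
have H := weighted_hoelder p1 mw w0 mJ iw mphi phi01.
rewrite -ae_weight_norm// -lee_fin !EFinM -poweR_EFin.
have fE (h : R -> R) : mu.-integrable J (EFin \o h) ->
    (Rintegral mu J h)%:E = (\int[mu]_(x in J) (h x)%:E)%E.
  by move=> ih; rewrite /Rintegral fineK//; apply: integrable_fin_num.
rewrite (fE phi)// (fE (fun x => phi x * w x))//.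
have wJ0 : (0 <= (Rintegral mu J w)%:E)%E by rewrite lee_fin Rintegral_weight_ge0.
apply: (le_trans (lee_wpmul2l wJ0 H)).
rewrite muleCA [leRHS]muleC; apply: lee_wpmul2l.
  rewrite -fE// lee_fin ae_weight_norm//; apply: Rintegral_ge0 => x _.
  by rewrite mulr_ge0//; case/andP: (phi01 x).
have W0 : (0 <= wmass (dual_weight p w) J)%E.
  by apply: integral_ge0 => x _; rewrite lee_fin powR_ge0.
have lenE : wmass (dual_weight p w) J = ((len J)%:E * eavg (dual_weight p w) J)%E.
  by rewrite /eavg muleA -EFinM mulfV ?mul1e// gt_eqF.
have e0 : (0 <= eavg (dual_weight p w) J)%E.
  by rewrite mule_ge0// lee_fin invr_ge0 ltW.
rewrite lenE poweRM ?lee_fin ?(ltW J0)// poweR_EFin.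
rewrite -(len_avg hD)// EFinM -eavgE//.
have lenM : ((len J)%:E * (len J `^ (p - 1))%:E = (len J `^ p)%:E)%E.
  rewrite -EFinM -{1}(powRr1 (ltW J0)) -powRD; last by rewrite (gt_eqF J0) implybT.
  by congr (_ `^ _)%:E; ring.
rewrite -[X in (X <= _)%E]muleA [X in (_ * X)%E]muleCA muleA lenM.
rewrite (fineK Ap_const_fin).
rewrite [leRHS]muleC; apply: lee_wpmul2l; first by rewrite lee_fin powR_ge0.
by apply: ereal_sup_ubound; exists J.
Qed.

Lemma Ap_doubling J K : D J -> D K -> K `<=` J -> len K = len J / 2 ->
  avg w J <= A * 2 `^ p / 2 * avg w K.
Proof.
move=> DJ DK KJ lK; have J0 := len_gt0 hD DJ; have mK := grid_measurable hD DK.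
have m1 : measurable_fun setT (\1_K : R -> R) by exact: measurable_indic.
have := @Ap_testing (\1_K) J DJ m1.
have KE (h : R -> R) : Rintegral mu J (fun x => \1_K x * h x) = Rintegral mu K h.
  rewrite -[in RHS](setIidr KJ) Rintegral_mkcondr; apply: eq_Rintegral => x _.
  by rewrite patchE indicE; case: ifP => _; rewrite ?mul1r ?mul0r.
have -> : Rintegral mu J (\1_K : R -> R) = len J / 2.
  transitivity (Rintegral mu J (fun x => \1_K x * 1)).
    by apply: eq_Rintegral => x _; rewrite mulr1.
  by rewrite (KE (cst 1)) (@Rintegral_cst _ _ _ mu K mK) mul1r -lK.
rewrite KE -(Rintegral_weight_norm DK) => h.
have b01 : forall x, 0 <= (\1_K : R -> R) x <= 1.
  by move=> x; rewrite indicE; case: (x \in K); rewrite /= ?lexx ler01.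
have {h} := h b01; rewrite powRM ?invr_ge0 ?(ltW J0)// mulrA [A * _]mulrC.
rewrite -!mulrA [X in X <= _]mulrCA ler_pM2l ?powR_gt0//.
rewrite /avg lK => h.
have P2 : 0 < 2 `^ p :> R by exact: powR_gt0.
have P2V : 2^-1 `^ p = (2 `^ p)^-1 :> R.
  by rewrite -powR_inv1 ?ler0n// -powRrM mulN1r powRN.
rewrite P2V ler_pdivrMr// in h.
rewrite [leLHS]mulrC ler_pdivrMr//; apply: (le_trans h).
rewrite le_eqVlt; apply/orP; left; apply/eqP; field.
by rewrite gt_eqF.
Qed.

End Ap_weights.

(** * Packing a Carleson family against a weight *)

Section carleson_packing.
Context {R : realType} {D : set (set R)} (hD : dyadic_grid D).
Variables (w : R -> R) (p L : R) (S : set (set R)).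
Implicit Types (I J K : set R) (x y : R) (s : seq (set R)).
Hypotheses (p1 : 1 < p) (hw : Ap D p w) (hS : Carleson D S L).
Local Notation mu := (@lebesgue_measure R).
Local Notation A := (fine (Ap_const D p w)).

Lemma sparse_grid I : S I -> D I. Proof. by case: hS => + _ _; exact. Qed.

Let lw : locally_integrable setT w. Proof. by case: hw => -[]. Qed.
Let mw : measurable_fun setT w. Proof. by case: lw. Qed.
Let L1 : 1 < L. Proof. by case: hS. Qed.
Let L0 : 0 < L. Proof. exact: lt_trans L1. Qed.

Lemma carleson_seq s K : D K -> uniq s -> (forall I, I \in s -> S I) ->
  \sum_(I <- s | `[< I `<=` K >]) len I <= L * len K.
Proof.
move=> DK us sS; case: hS => _ _ /(_ K DK); rewrite (grid_mu hD DK) -EFinM => h.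
rewrite -lee_fin; apply: le_trans h.
rewrite -big_filter; set t := [seq _ <- _ | _].
have tS I : I \in t -> S I /\ I `<=` K.
  by rewrite mem_filter => /andP[/asboolP IK /sS].
rewrite -sumEFin; apply: esum_ge; exists [set` t]; first by split; [exact: finite_seq|move=> I /tS].
rewrite -fsbig_seq ?filter_uniq// le_eqVlt; apply/orP; left; apply/eqP.
by apply: eq_big_seq => I /tS[/sparse_grid DI _]; rewrite (grid_mu hD DI).
Qed.

(** The sparse sets of a finite Carleson family, in fractional form: g is the sum
    of densities phi <= 1 on the members I, each of integral |I| / L, and the total
    stays below 1. They are added from the shortest member to the longest. When I
    comes, the Carleson condition on I leaves g with mass at most (1 - 1/L) |I| in
    I, so that a multiple c <= 1 of 1 - g on I has the required integral. Unlike
    sets of prescribed measure, the densities are explicit. The formula for the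
    mass of g is what the next step needs, and testing the weight against each
    phi bounds the sum of the w(I). *)
Lemma carleson_density J s : D J -> uniq s -> (forall I, I \in s -> S I /\ I `<=` J) ->
  sorted (fun I K => len I <= len K) s ->
  exists g : R -> R, [/\ measurable_fun setT g, forall x, 0 <= g x <= 1,
    forall K, D K -> (forall I, I \in s -> len I <= len K) ->
      Rintegral mu K g = L^-1 * \sum_(I <- s | `[< I `<=` K >]) len I &
    \sum_(I <- s) Rintegral mu I w <=
      A * L `^ p * Rintegral mu J (fun x => g x * `|w x|)].
Proof.
move=> DJ; elim/last_ind: s => [|s I IH].
  move=> _ _ _; exists (cst 0); split => [||K DK _|].
  - exact: measurable_cst.
  - by move=> x /=; rewrite lexx ler01.
  - by rewrite big_nil mulr0 (@Rintegral_cst _ _ _ mu K (grid_measurable hD DK)) mul0r.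
  - rewrite big_nil; under eq_Rintegral do rewrite /= mul0r.
    by rewrite (@Rintegral_cst _ _ _ mu J (grid_measurable hD DJ)) mul0r mulr0.
rewrite rcons_uniq => /andP[Is us] sJ ss.
have [SI IJ] : S I /\ I `<=` J by apply: sJ; rewrite mem_rcons inE eqxx.
have DI := sparse_grid SI; have I0 := len_gt0 hD DI.
have sJ' K : K \in s -> S K /\ K `<=` J.
  by move=> Ks; apply: sJ; rewrite mem_rcons inE Ks orbT.
have sI K : K \in s -> len K <= len I.
  move=> Ks; move: ss; rewrite -cats1 sorted_pairwise => [|? ? ?]; last exact: le_trans.
  by rewrite pairwise_cat => /andP[/allrelP h _]; apply: h => //; rewrite inE.
have ss' : sorted (fun I K => len I <= len K) s.
  by move: ss; rewrite -cats1 => /cat_sorted2[].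
have [g [mg g01 gK gw]] := IH us sJ' ss'.
have mI := grid_measurable hD DI.
have ib (h : R -> R) := @unit_fun_integrable _ _ hD h.
pose m := Rintegral mu I g.
have mE : m = L^-1 * \sum_(K <- s | `[< K `<=` I >]) len K by exact: gK.
have room : len I / L <= len I - m.
  have uI : uniq (rcons s I) by rewrite rcons_uniq Is.
  have SS K : K \in rcons s I -> S K by move=> /sJ[].
  have := carleson_seq DI uI SS; rewrite -cats1 big_cat/= big_cons big_nil asboolT// addr0.
  by rewrite mE lerBrDr [len I / L]mulrC -mulrDr ler_pdivrMl// addrC.
have rpos : 0 < len I / L by rewrite divr_gt0.
have room0 : 0 < len I - m := lt_le_trans rpos room.
pose c := (len I / L) / (len I - m).
have c01 : 0 <= c <= 1.
  by rewrite /c divr_ge0 ?(ltW rpos) ?(ltW room0)//= ler_pdivrMr// mul1r.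
pose phi x := c * ((1 - g x) * \1_I x).
have m1 : measurable_fun setT (\1_I : R -> R) by exact: measurable_indic.
have mphi : measurable_fun setT phi.
  apply: measurable_funM => //; apply: measurable_funM => //.
  by apply: measurable_funB.
have phi1 x : 0 <= phi x <= 1 - g x.
  have /andP[a b] := g01 x; case/andP: c01 => c0 c1.
  rewrite /phi indicE; case: (x \in I) => /=; rewrite ?mulr0 ?lexx ?subr_ge0 ?b//.
  by rewrite mulr1 mulr_ge0 ?subr_ge0//= ler_piMl// subr_ge0.
have phi01 x : 0 <= phi x <= 1.
  have /andP[-> h] := phi1 x; have /andP[a b] := g01 x.
  by rewrite (le_trans h)// lerBlDr lerDl.
have phi_sub K : D K -> I `<=` K -> Rintegral mu K phi = len I / L.
  move=> DK IK.
  transitivity (c * Rintegral mu I (fun x => 1 - g x)).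
    rewrite -RintegralZl//.
    rewrite -[in RHS](setIidr IK) Rintegral_mkcondr; apply: eq_Rintegral => x _.
      by rewrite /phi patchE indicE; case: ifP => _; rewrite ?mulr1 ?mulr0.
    have := @integrableB _ _ _ mu I mI (EFin \o cst 1) (EFin \o g); apply.
      by apply: ib => // x /=; rewrite ler01 lexx.
    exact: ib.
  rewrite RintegralB//;
    [|by apply: ib => // x /=; rewrite ler01 lexx|exact: ib].
  rewrite (@Rintegral_cst _ _ _ mu I mI) mul1r -/(len I) -/m /c divfK//.
  by rewrite gt_eqF.
exists (fun x => g x + phi x); split.
- exact: measurable_funD.
- move=> x; have /andP[a b] := g01 x; have /andP[c' d] := phi1 x.
  by rewrite addr_ge0//= -lerBrDl.
- move=> K DK sK; have mK := grid_measurable hD DK.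
  have IK : len I <= len K by apply: sK; rewrite mem_rcons inE eqxx.
  rewrite RintegralD//; [|exact: ib|exact: ib].
  rewrite gK//; last first.
    by move=> I' I's; apply: sK; rewrite mem_rcons inE I's orbT.
  rewrite -cats1 big_cat/= big_cons big_nil mulrDr; congr (_ + _).
  case: asboolP => IsubK; first by rewrite phi_sub// addr0 mulrC.
  rewrite mulr0; transitivity (Rintegral mu K (cst 0)).
    apply: eq_Rintegral => x; rewrite inE => Kx; rewrite /phi indicE memNset ?mulr0//.
    by move=> Ix; apply: IsubK; exact: (grid_nested hD DI DK IK Ix Kx).
  by rewrite (@Rintegral_cst _ _ _ mu K mK) mul0r.
- have lnw := locally_integrable_norm lw; have mJ := grid_measurable hD DJ.
  have iw (h : R -> R) : measurable_fun setT h -> (forall x, 0 <= h x <= 1) ->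
      mu.-integrable J (EFin \o (fun x => h x * `|w x|)).
    move=> mh h01; apply: unit_fun_mul_integrable => //.
    exact: (grid_integrable hD).
  rewrite (@eq_Rintegral _ _ _ mu J (fun x => g x * `|w x| + phi x * `|w x|)
    (fun x => (g x + phi x) * `|w x|)); last by move=> x _; rewrite mulrDl.
  rewrite RintegralD//; [|exact: iw|exact: iw].
  rewrite -cats1 big_cat/= big_seq1 mulrDr lerD//.
  have phiI : Rintegral mu J (fun x => phi x * `|w x|) =
      Rintegral mu I (fun x => phi x * `|w x|).
    rewrite -[in RHS](setIidr IJ) Rintegral_mkcondr; apply: eq_Rintegral => x _.
    rewrite patchE; case: ifPn => // Ix.
    by rewrite /phi indicE (negbTE Ix) !mulr0 mul0r.
  have := Ap_testing hD p1 hw DI mphi phi01.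
  rewrite (phi_sub I)// phiI powRM ?invr_ge0 ?(ltW I0) ?(ltW L0)//.
  rewrite mulrCA [A * _]mulrC -[X in _ <= X]mulrA ler_pM2l ?powR_gt0//.
  have -> : L^-1 `^ p = (L `^ p)^-1.
    by rewrite -powR_inv1 ?(ltW L0)// -powRrM mulN1r powRN.
  by rewrite ler_pdivrMr ?powR_gt0// mulrAC.
Qed.

(** An infinite sum of nonnegative terms is the supremum of its finite partial
    sums, so finite families suffice. *)
Lemma carleson_weight_sum J : D J ->
  (\esum_(I in [set I | S I /\ I `<=` J]) wmass w I <=
   (A * L `^ p * Rintegral mu J w)%:E)%E.
Proof.
move=> DJ; apply: ge_ereal_sup => _ [X [fX XS] <-].
have tot : total (fun I K => len I <= len K) by move=> I K; exact: le_total.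
pose s := sort (fun I K => len I <= len K) (finmap.enum_fset (fset_set X)).
have us : uniq s by rewrite sort_uniq finmap.fset_uniq.
have sS I : I \in s -> S I /\ I `<=` J.
  by rewrite mem_sort in_fset_set// inE => /XS.
have [g [mg g01 _ gw]] := carleson_density DJ us sS (sort_sorted tot _).
rewrite fsbig_finite//=.
rewrite -(perm_big _ (permEl (perm_sort (fun I K => len I <= len K) _)))/=.
rewrite -/s big_seq (eq_bigr (fun I => (Rintegral mu I w)%:E)); last first.
  by move=> I /sS[/sparse_grid DI _]; exact: (wmassE hD hw).
rewrite -big_seq sumEFin lee_fin; apply: (le_trans gw).
rewrite ler_wpM2l ?mulr_ge0 ?powR_ge0 ?(Ap_const_ge0 hD hw)//.
rewrite (Rintegral_weight_norm hD hw DJ).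
have mJ := grid_measurable hD DJ.
apply: (@le_Rintegral _ _ _ mu) => //.
- apply: unit_fun_mul_integrable => //.
  exact: (grid_integrable hD (locally_integrable_norm lw)).
- exact: (grid_integrable hD (locally_integrable_norm lw)).
- by move=> x _; have /andP[f0 f1] := g01 x; rewrite ler_piMl.
Qed.

Lemma tau_le J : D J -> (tau S w J <= (A * L `^ p * avg w J)%:E)%E.
Proof.
move=> DJ; have J0 := len_gt0 hD DJ.
rewrite /tau /avg mulrCA EFinM lee_pmul2l ?lte_fin ?invr_gt0//.
apply: (le_trans _ (carleson_weight_sum DJ)).
have w0 I : S I -> (0 <= wmass w I)%E.
  move=> /sparse_grid DI; rewrite (wmassE hD hw)// lee_fin.
  exact: (Rintegral_weight_ge0 hD hw).
rewrite [leRHS](esumID [set I | I `<` J]); last by move=> I [/w0].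
rewrite (_ : [set I | S I /\ I `<=` J] `&` [set I | I `<` J] =
    [set I | S I /\ I `<` J]).
  by apply: leeDl; apply: esum_ge0 => I [[/w0]].
by apply/seteqP; split => I /= => [[[SI IJ] IJ']//|[SI [IJ IJ']]].
Qed.

Lemma tau_ge0 J : D J -> (0 <= tau S w J)%E.
Proof.
move=> DJ; have J0 := len_gt0 hD DJ.
rewrite /tau mule_ge0// ?lee_fin ?invr_ge0 ?(ltW J0)//.
apply: esum_ge0 => I [/sparse_grid DI _].
by rewrite (wmassE hD hw)// lee_fin (Rintegral_weight_ge0 hD hw).
Qed.

End carleson_packing.

(** * Countable families of nonnegative terms *)

Section countable_families.
Context {R : realType} {T : choiceType}.
Local Notation mu := (@lebesgue_measure R).
Implicit Types (A : set T) (F : T -> R -> \bar R).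

(** A countable set is enumerated with gaps, marked by [None], which spares a case
    distinction between finite and infinite sets. *)
Lemma countable_esum A : countable A -> exists h : nat -> option T,
  (forall n i, h n = Some i -> A i) /\
  forall a : T -> \bar R, (forall i, A i -> 0 <= a i)%E ->
    \esum_(i in A) a i = (\sum_(n <oo) if h n is Some i then a i else 0)%E.
Proof.
move=> /countable_injP[f finj].
pose h n := if pselect (exists i, A i /\ f i = n) is left e
            then Some (projT1 (cid e)) else None.
have hA n i : h n = Some i -> A i /\ f i = n.
  by rewrite /h; case: pselect => // e [<-]; case: cid.
have hf i : A i -> h (f i) = Some i.
  move=> Ai; rewrite /h; case: pselect => [e|]; last by case; exists i.
  case: cid => j [Aj fj] /=; congr Some; apply: finj => //; exact: mem_set.
exists h; split => [n i /hA[]//|a a0].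
pose a' n := if h n is Some i then a i else 0%E.
have a'0 n : (0 <= a' n)%E.
  by rewrite /a'; case E : (h n) => [i|//]; apply: a0; case: (hA _ _ E).
rewrite -[RHS]/(\sum_(n <oo) a' n)%E nneseries_esumT//.
transitivity (\esum_(n in f @` A) a' n).
  rewrite esum_image; first by apply: eq_esum => i Ai; rewrite /a' hf.
  by move=> i j iA jA; exact: finj.
rewrite esum_mkcond; apply: eq_esum => n _; case: ifPn => // nA.
rewrite /a'; case E : (h n) => [i|//]; have [Ai fi] := hA _ _ E.
by move: nA; rewrite notin_setE => /(_ (ex_intro2 _ _ i Ai fi)).
Qed.

Lemma measurable_countable_esum A F : countable A ->
  (forall i, A i -> measurable_fun setT (F i)) ->
  (forall i x, A i -> 0 <= F i x)%E ->
  measurable_fun setT (fun x => \esum_(i in A) F i x).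
Proof.
move=> cA mF F0; have [h [hA hE]] := countable_esum cA.
rewrite (_ : (fun x => _) = fun x => (\sum_(n <oo | n \in predT)
    if h n is Some i then F i x else 0)%E); last first.
  by apply/funext => x; rewrite hE// => i; exact: F0.
apply: ge0_emeasurable_sum => [k x _ _|k _].
  by case E : (h k) => [i|//]; apply: F0; exact: hA E.
by case E : (h k) => [i|]; [apply: mF; exact: hA E|exact: measurable_cst].
Qed.

Lemma integral_countable_esum A F (E : set R) : countable A -> measurable E ->
  (forall i, A i -> measurable_fun setT (F i)) ->
  (forall i x, A i -> 0 <= F i x)%E ->
  (\int[mu]_(x in E) (\esum_(i in A) F i x) =
   \esum_(i in A) \int[mu]_(x in E) F i x)%E.
Proof.
move=> cA mE mF F0; have [h [hA hE]] := countable_esum cA.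
rewrite hE; last by move=> i Ai; apply: integral_ge0 => x _; exact: F0.
transitivity (\int[mu]_(x in E)
    (\sum_(n <oo) (if h n is Some i then F i x else 0)))%E.
  by apply: eq_integral => x _; rewrite hE// => i; exact: F0.
rewrite (@integral_nneseries _ _ _ mu E mE
  (fun n x => if h n is Some i then F i x else 0%E)).
- apply: eq_eseriesr => n _; case: (h n) => //; exact: integral0.
- move=> n; case H : (h n) => [i|]; last exact: measurable_cst.
  by apply: measurable_funTS; apply: mF; exact: hA H.
- by move=> n x _; case H : (h n) => [i|//]; apply: F0; exact: hA H.
Qed.

Lemma esum1_finite A : (\esum_(i in A) (1 : \bar R) < +oo)%E -> finite_set A.
Proof.
move=> h; apply: contrapT => iA.
have : (\esum_(i in A) (1 : \bar R) = +oo)%E.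
  apply/eqyP => r r0.
  have [B BA nB] := @infinite_set_fset _ A (Num.truncn r).+1 iA.
  apply: esum_ge; exists [set` finmap.enum_fset B]; first by split.
  rewrite fsbig_finite//= set_fsetK sumEFin lee_fin.
  have -> : \sum_(i <- finmap.enum_fset B) 1 = (size (finmap.enum_fset B))%:R :> R.
    by rewrite big_const_seq count_predT iter_addr_0.
  by rewrite (le_trans (ltW (truncnS_gt r)))// ler_nat.
by move=> E; rewrite E ltxx in h.
Qed.

End countable_families.

(** * Sparse families and their symbols *)

Section sparse_families.
Context {R : realType} {D : set (set R)} (hD : dyadic_grid D).
Variables (L : R) (S : set (set R)).
Implicit Types (I J K : set R) (x y : R).
Hypotheses (hS : Carleson D S L) (hchain : ~ infinite_increasing_chain S).
Local Notation mu := (@lebesgue_measure R).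

Let sD I : S I -> D I. Proof. exact: (sparse_grid hS). Qed.

Lemma sparse_countable : countable S.
Proof. exact: (sub_countable (subset_card_le sD) (grid_countable hD)). Qed.

(** The members of S that contain J form a chain. Only finitely many are smaller
    than a given one, so if there were infinitely many, each would lie properly
    in another, and they would yield an increasing sequence. *)
Lemma finite_larger J : D J -> finite_set [set I | S I /\ J `<=` I].
Proof.
move=> DJ; apply: contrapT => iT.
have [x Jx] := grid_neq0 hD DJ; have [j Jj] := grid_len hD DJ.
have step I : S I /\ J `<=` I -> exists K, (S K /\ J `<=` K) /\ I `<` K.
  move=> [SI JI]; apply: contrapT => nK; apply: iT.
  have DI := sD SI; have [i Ii] := grid_len hD DI.
  apply: (@sub_finite_set _ _
    [set cell D (j + n%:Z) x | n in `I_(absz (i - j)).+1]); last first.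
    exact/finite_image/finite_II.
  move=> K [SK JK]; have DK := sD SK; have [k Kk] := grid_len hD DK.
  have KI : K `<=` I.
    have [h|h] := leP (len K) (len I).
      exact: (grid_nested hD DK DI h (JK _ Jx) (JI _ Jx)).
    exfalso; apply: nK; exists K; split => //; split.
      exact: (grid_nested hD DI DK (ltW h) (JI _ Jx) (JK _ Jx)).
    by move=> /(grid_subset_len hD DK DI); rewrite leNgt h.
  have jk : (j <= k).
    by rewrite -(@ler_eXz2l _ (2 : R)) ?ltr1n// -Jj -Kk (grid_subset_len hD).
  have ki : (k <= i).
    by rewrite -(@ler_eXz2l _ (2 : R)) ?ltr1n// -Ii -Kk (grid_subset_len hD).
  exists (absz (k - j)) => /=; first by lia.
  apply/esym; apply: (cell_eq hD DK); last exact: JK.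
  by rewrite Kk; congr (_ ^ _); lia.
have [I0 [SI0 JI0]] := infinite_setN0 iT.
pose X := {I | S I /\ J `<=` I}.
have stepX (I : X) : {K : X | projT1 I `<` projT1 K}.
  apply: cid; have [K [HK IK]] := step _ (projT2 I).
  by exists (exist _ K HK).
have [f [_ fS]] := dependent_choice stepX (exist _ I0 (conj SI0 JI0)).
apply: hchain; exists (fun n => projT1 (f n)) => k; split; last exact: fS.
by case: (f k) => I [].
Qed.

(** In a unit cell the members of S inside the cell have a counting function of
    finite integral, by the Carleson condition; the larger ones are finitely many
    in number. *)
Lemma ae_finite_members : {ae mu, forall x, finite_set [set I | S I /\ I x]}.
Proof.
have local (z : int) : {ae mu, forall x,
    cell D 0 (z%:~R / 2) x -> finite_set [set I | S I /\ I x]}.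
  set J := cell D 0 _; have DJ : D J := cell_grid hD _ _.
  have mJ := grid_measurable hD DJ.
  pose SJ := [set I | S I /\ I `<=` J].
  have cSJ : countable SJ.
    by apply: (sub_countable _ sparse_countable); apply: subset_card_le => I [].
  pose F I := fun x : R => (\1_I x)%:E : \bar R.
  have mF I : SJ I -> measurable_fun setT (F I).
    move=> [/sD DI _]; apply/measurable_EFinP; apply: measurable_indic.
    exact: (grid_measurable hD DI).
  have F0 I x : SJ I -> (0 <= F I x)%E by move=> _; rewrite lee_fin.
  have iE : (\int[mu]_(x in J) (\esum_(I in SJ) F I x) <= L%:E * mu J)%E.
    rewrite integral_countable_esum//; case: hS => _ _ /(_ J DJ); apply: le_trans.
    apply: le_esum => I [/sD DI IJ]; rewrite /F integral_indic ?(setIidl IJ)//.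
    exact: (grid_measurable hD DI).
  have mE : measurable_fun setT (fun x => \esum_(I in SJ) F I x).
    exact: measurable_countable_esum.
  have : mu.-integrable J (fun x => \esum_(I in SJ) F I x).
    apply/integrableP; split; first exact: measurable_funTS.
    have -> : (\int[mu]_(x in J) `|\esum_(I in SJ) F I x| =
        \int[mu]_(x in J) (\esum_(I in SJ) F I x))%E.
      apply: eq_integral => x _; rewrite gee0_abs//.
      by apply: esum_ge0 => I SI; exact: F0.
    by apply: (le_lt_trans iE); rewrite (grid_mu hD DJ) -EFinM ltry.
  move=> iI; apply: (ae_mono (@integrable_ae _ _ _ mu J mJ _ iI)) => x fx Jx.
  have f1 : finite_set (SJ `&` [set I | I x]).
    apply: (@esum1_finite R); rewrite esum_mkcondr.
    have := fx Jx; rewrite fin_numElt => /andP[_]; apply: le_lt_trans.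
    apply: le_esum => I _; rewrite /F indicE.
    case: ifPn => [|_]; last by case: (x \in I).
    by rewrite inE => /= Ix; rewrite mem_set.
  apply: (@sub_finite_set _ _
    ((SJ `&` [set I | I x]) `|` [set I | S I /\ J `<=` I])).
    move=> I [SI Ix]; have DI := sD SI.
    have [h|h] := leP (len I) (len J).
      by left; split => //; split => //; exact: (grid_nested hD DI DJ h Ix Jx).
    by right; split => //; exact: (grid_nested hD DJ DI (ltW h) Jx Ix).
  by rewrite finite_setU; split => //; exact: finite_larger.
apply: (@ae_mono _ (fun x => forall n, if unpickle n is Some z then
    cell D 0 ((z : int)%:~R / 2) x -> finite_set [set I | S I /\ I x] else True)).
  apply: ae_forall_nat => n; case: unpickle => [z|]; first exact: local.
  by apply: (@ae_outside _ set0) => //; exact: negligible_set0.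
move=> x h; have [z _ zx] := unit_cells_cover hD (Logic.I : setT x).
by have := h (pickle z); rewrite pickleK; apply.
Qed.

End sparse_families.

Section sparse_symbol.
Context {R : realType} {D : set (set R)} (hD : dyadic_grid D).
Variables (w : R -> R) (p L : R) (S : set (set R)).
Implicit Types (I J K : set R) (x y : R).
Hypotheses (hw : Ap D p w) (hS : Carleson D S L)
  (hchain : ~ infinite_increasing_chain S).
Local Notation mu := (@lebesgue_measure R).
Local Notation A := (fine (Ap_const D p w)).
Local Notation b := (sparse_symbol S w).
Local Notation T := (fun J => fine (tau S w J)).

Let sD I : S I -> D I. Proof. exact: (sparse_grid hS). Qed.
Let lw : locally_integrable setT w. Proof. by case: hw => -[]. Qed.
Let wI0 I : S I -> 0 <= avg w I.
Proof. by move=> /sD; exact: (avg_weight_ge0 hD hw). Qed.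

Local Notation finite_larger := (finite_larger hD hS hchain).
Local Notation sparse_countable := (sparse_countable hD hS).

(** The part of the symbol that is constant on J. *)
Definition larger_sum J : R := \sum_(I \in [set I | S I /\ J `<=` I]) avg w I.

Lemma esum_larger (J : set R) : D J ->
  (\esum_(I in [set I | S I /\ J `<=` I]) (avg w I)%:E = (larger_sum J)%:E)%E.
Proof.
move=> DJ; have fJ := finite_larger DJ.
rewrite esum_fset//; last first.
  by move=> I; rewrite inE => -[SI _]; rewrite lee_fin wI0.
by rewrite /larger_sum !fsbig_finite//= sumEFin.
Qed.

(** A member of S properly containing a child of J has at least the length of J,
    so it contains J. *)
Lemma larger_sum_child J K : D J -> D K -> K `<=` J -> len K = len J / 2 ->
  larger_sum K = larger_sum J + (if `[< S K >] then avg w K else 0).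
Proof.
move=> DJ DK KJ lK; have [x Kx] := grid_neq0 hD DK.
have EK := esum_larger DK; have EJ := esum_larger DJ.
apply: EFin_inj; rewrite EFinD -EK -EJ.
rewrite (esumID [set I | J `<=` I]); last first.
  by move=> I [SI _]; rewrite lee_fin wI0.
congr (_ + _)%E.
  congr esum; apply/seteqP; split => I /=; first by move=> [[SI _] JI].
  by move=> [SI JI]; split => //; split => //; exact: subset_trans JI.
rewrite (_ : _ `&` _ = [set I | S I /\ I = K]).
  case: asboolP => [SK|nSK].
    rewrite (_ : [set I | S I /\ I = K] = [set K]).
      by rewrite esum_set1// lee_fin wI0.
    by apply/seteqP; split => I /=; [case|move=> ->].
  rewrite (_ : [set I | _] = set0) ?esum_set0//.
  by apply/seteqP; split => I //= -[SI IK]; apply: nSK; rewrite -IK.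
apply/seteqP; split => I /= => [[[SI KI] nJI]|[SI IE]].
  split => //; have DI := sD SI; apply: contrapT => IK; apply: nJI.
  have KI' : K `<` I by split => // IK'; apply: IK; apply/seteqP; split.
  apply: (grid_nested hD DJ DI _ (KJ _ Kx) (KI _ Kx)).
  by have := grid_proper_len hD DK DI KI'; rewrite lK; lra.
rewrite {I}IE in SI *; split; first by split=> //; exact: subset_refl.
move=> /= JK; have := grid_subset_len hD DJ DK JK; have := len_gt0 hD DJ.
by rewrite lK; lra.
Qed.

Let B x : \bar R := \esum_(I in S) (avg w I * \1_I x)%:E.

Let B0 x : (0 <= B x)%E.
Proof. by apply: esum_ge0 => I SI; rewrite lee_fin mulr_ge0// wI0. Qed.

Let mF I : S I -> measurable_fun setT (fun x => (avg w I * \1_I x)%:E).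
Proof.
move=> SI; apply/measurable_EFinP; apply: measurable_funM => //.
by apply: measurable_indic; exact: (grid_measurable hD (sD SI)).
Qed.

Let mB : measurable_fun setT B.
Proof.
apply: measurable_countable_esum => //; first exact: sparse_countable.
by move=> I x SI; rewrite lee_fin mulr_ge0// wI0.
Qed.

Let mb : measurable_fun setT b.
Proof. exact: (measurableT_comp (@fine_measurable _ _ measurableT) mB). Qed.

Hypothesis p1 : 1 < p.

Lemma tau_fin J : D J -> tau S w J = (T J)%:E.
Proof.
move=> DJ; rewrite fineK// ge0_fin_numE; last exact: (tau_ge0 hD hw hS).
by apply: (le_lt_trans (tau_le hD p1 hw hS DJ)); rewrite ltry.
Qed.

(** A member of S meeting J lies properly inside J or contains J; the first kind
    gives tau and the second the constant part. *)
Let integral_B J : D J ->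
  (\int[mu]_(x in J) B x)%E = (len J * (T J + larger_sum J))%:E.
Proof.
move=> DJ; have mJ := grid_measurable hD DJ; have J0 := len_gt0 hD DJ.
have F0 I x : S I -> (0 <= (avg w I * \1_I x)%:E)%E.
  by move=> SI; rewrite lee_fin mulr_ge0// wI0.
rewrite /B integral_countable_esum//; last exact: sparse_countable.
have iE I : S I ->
    (\int[mu]_(x in J) (avg w I * \1_I x)%:E = (avg w I)%:E * mu (I `&` J))%E.
  move=> SI; have mI := grid_measurable hD (sD SI).
  under eq_integral do rewrite EFinM.
  rewrite ge0_integralZl// ?integral_indic ?lee_fin ?wI0//.
  by apply: measurable_funTS; apply/measurable_EFinP; exact: measurable_indic.
rewrite (eq_esum iE) (esumID [set I | I `<` J]); last first.
  by move=> I SI; rewrite mule_ge0// lee_fin wI0.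
rewrite mulrDr EFinD; congr (_ + _)%E.
  rewrite EFinM -tau_fin// /tau muleA -EFinM mulfV ?gt_eqF// mul1e.
  apply: eq_esum => I [SI [IJ _]]; have DI := sD SI.
  rewrite (setIidl IJ) (grid_mu hD DI) (wmassE hD hw DI) -(len_avg hD _ DI).
  by rewrite -EFinM mulrC.
rewrite EFinM -esum_larger//.
transitivity (\esum_(I in [set I | S I /\ J `<=` I])
    ((len J)%:E * (avg w I)%:E))%E; last first.
  have fJ := finite_larger DJ.
  have w0 I : I \in [set I | S I /\ J `<=` I] -> (0 <= (avg w I)%:E)%E.
    by rewrite inE => -[SI _]; rewrite lee_fin wI0.
  rewrite !esum_fset// => [|I /w0 wI]; last by rewrite mule_ge0// lee_fin ltW.
  rewrite !fsbig_finite//.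
  rewrite (eq_bigr (fun I => (len J * avg w I)%:E))//.
  by rewrite !sumEFin -EFinM mulr_sumr.
rewrite esum_mkcond [RHS]esum_mkcond; apply: eq_esum => I _.
case: ifPn => [|/negP]; rewrite inE.
  move=> [SI nIJ]; have DI := sD SI; case: ifPn => [|/negP]; rewrite inE.
    by move=> [_ JI]; rewrite (setIidr JI) (grid_mu hD DJ) muleC.
  move=> nJI; rewrite (_ : I `&` J = set0) ?measure0 ?mule0//.
  apply/seteqP; split => // x [Ix Jx].
  have [h|h] := leP (len J) (len I).
    by apply: nJI; split => //; exact: (grid_nested hD DJ DI h Jx Ix).
  apply: nIJ; split; first exact: (grid_nested hD DI DJ (ltW h) Ix Jx).
  by move=> /(grid_subset_len hD DJ DI); rewrite leNgt h.
move=> nI; case: ifPn => //; rewrite inE => -[SI JI].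
exfalso; apply: nI; split => //= -[_ nJI]; exact: nJI.
Qed.

Let iB J : D J -> mu.-integrable J B.
Proof.
move=> DJ; apply/integrableP; split; first exact: measurable_funTS.
have -> : (\int[mu]_(x in J) `|B x| = \int[mu]_(x in J) B x)%E.
  by apply: eq_integral => x _; rewrite gee0_abs.
by rewrite integral_B// ltry.
Qed.

Let fine_le_self (e : \bar R) : (0 <= e)%E -> (`|fine e|%:E <= e)%E.
Proof.
by case: e => [r||]//=; rewrite ?normr0 ?leey// !lee_fin => /ger0_norm ->.
Qed.

Lemma symbol_integrable J : D J -> mu.-integrable J (EFin \o b).
Proof.
move=> DJ; have mJ := grid_measurable hD DJ.
apply: (@le_integrable _ _ _ mu J mJ _ B).
- by apply/measurable_EFinP; exact: measurable_funTS.
- by move=> x _ /=; rewrite (gee0_abs (B0 x)); exact: (fine_le_self (B0 x)).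
- exact: iB.
Qed.

Let ae_B_fin J : D J -> {ae mu, forall x, J x -> (b x)%:E = B x}.
Proof.
move=> DJ; have mJ := grid_measurable hD DJ.
apply: (ae_mono (@integrable_ae _ _ _ mu J mJ _ (iB DJ))) => x fx Jx.
by rewrite /sparse_symbol fineK//; exact: fx.
Qed.

Lemma avg_symbol J : D J -> avg b J = T J + larger_sum J.
Proof.
move=> DJ; have mJ := grid_measurable hD DJ; have J0 := len_gt0 hD DJ.
rewrite /avg /Rintegral.
have -> : (\int[mu]_(x in J) (b x)%:E = \int[mu]_(x in J) B x)%E.
  apply: ae_eq_integral => //.
  - by apply/measurable_EFinP; exact: measurable_funTS.
  - exact: measurable_funTS.
  - exact: ae_B_fin.
by rewrite integral_B//= mulrA mulVf ?mul1r// gt_eqF.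
Qed.

(** Finitely many unit cells cover a compact set. *)
Lemma symbol_locally_integrable : locally_integrable setT b.
Proof.
split => //; first exact: openT.
move=> K _ cK; have [M [_ KM]] := compact_bounded cK.
pose N := (Num.truncn `|M + 1|).+1.
have {}KM x : K x -> `|x| <= N%:R.
  move=> Kx; apply: (@le_trans _ _ (M + 1)); first by apply: KM; rewrite ?ltrDl.
  by rewrite (le_trans (ler_norm _))// ltW// truncnS_gt.
pose c i := cell D 0 ((i%:R - (2 * N + 2)%:R) / 2).
have Dc i : D (c i) by exact: cell_grid.
pose nb x := `|b x|%:E : \bar R.
have mnb : measurable_fun setT nb.
  by apply/measurable_EFinP; exact: measurableT_comp.
have mci i : measurable_fun setT (nb \_ (c i)).
  apply/(measurable_restrictT _ _).1; first exact: (grid_measurable hD).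
  exact: measurable_funTS.
have c0 i x : (0 <= (nb \_ (c i)) x)%E.
  by rewrite patchE; case: ifP => _; rewrite ?lee_fin.
rewrite integral_mkcond.
apply: (@le_lt_trans _ _ (\int[mu]_x (\sum_(i < 4 * N + 5) (nb \_ (c i)) x))%E).
  apply: ge0_le_integral => //.
  - by move=> x _; rewrite patchE; case: ifP => _; rewrite ?lee_fin.
  - apply/(measurable_restrictT _ _).1; first exact: compact_measurable.
    exact: measurable_funTS.
  - exact: (@emeasurable_sum _ _ _ setT _ (index_enum 'I_(4 * N + 5))
      (fun i => nb \_ (c i)) (fun i => mci i)).
  move=> x _; rewrite patchE; case: ifPn => [|_]; last exact: sume_ge0.
  rewrite inE => /KM/(unit_cells_cover_ball hD)[i iN xi].
  rewrite (bigD1 (Ordinal iN))//= patchE mem_set//.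
  by apply: leeDl; exact: sume_ge0.
rewrite ge0_integral_sum//; last by move=> i; exact: mci.
apply/lte_sum_pinfty => i _.
rewrite -integral_mkcond; have /integrableP[_] := symbol_integrable (Dc i).
by apply: le_lt_trans.
Qed.

(** It can fail on a null set: where the sum is infinite, the symbol takes the
    default value 0. *)
Lemma symbol_ge J : D J -> {ae mu, forall x, J x -> larger_sum J <= b x}.
Proof.
move=> DJ; apply: (ae_mono (ae_B_fin DJ)) => x bx Jx.
rewrite -lee_fin bx// -esum_larger//.
rewrite /B [leRHS](esumID [set I | J `<=` I]); last first.
  by move=> I SI; rewrite lee_fin mulr_ge0// wI0.
apply: (le_trans _ (leeDl _ _)); last first.
  by apply: esum_ge0 => I [SI _]; rewrite lee_fin mulr_ge0// wI0.
apply: le_esum => I [_ JI]; rewrite indicE mem_set ?mulr1//; exact: JI.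
Qed.

(** Replace the average of the symbol by its constant part: this costs tau J, and
    the remaining difference is nonnegative with average tau J. *)
Lemma symbol_oscillation J : D J ->
  (\int[mu]_(x in J) `|b x - avg b J|%:E <= (2 * len J * T J)%:E)%E.
Proof.
move=> DJ; have mJ := grid_measurable hD DJ; have J0 := len_gt0 hD DJ.
have muJ : (mu J < +oo)%E by rewrite (grid_mu hD DJ) ltry.
have T0 : 0 <= T J by apply: fine_ge0; exact: (tau_ge0 hD hw hS).
have ib := symbol_integrable DJ.
have ic (r : R) : mu.-integrable J (EFin \o cst r).
  apply: (@measurable_bounded_integrable _ _ _ mu (cst r) J mJ muJ).
    exact: measurable_cst.
  exists `|r|; split => // M M1 x _ /=; exact: ltW.
have idiff : mu.-integrable J
    (EFin \o (fun x => b x + cst (T J - larger_sum J) x)).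
  exact: (@integrableD _ _ _ mu J mJ _ _ ib (ic _)).
apply: (@le_trans _ _
    (\int[mu]_(x in J) (`|b x + cst (T J - larger_sum J) x|)%:E)%E).
  apply: ae_ge0_le_integral => //.
  - apply/measurable_EFinP; apply: measurableT_comp => //.
    by apply: measurable_funTS; apply: measurable_funB.
  - apply/measurable_EFinP; apply: measurableT_comp => //.
    by apply: measurable_funTS; exact: measurable_funD.
  apply: (ae_mono (symbol_ge DJ)) => x bx Jx; rewrite lee_fin.
  have {}bx := bx Jx; rewrite avg_symbol//=; rewrite [leRHS]ger0_norm; last by lra.
  by rewrite ler_norml; apply/andP; split; lra.
have -> : (\int[mu]_(x in J) (`|b x + cst (T J - larger_sum J) x|)%:E =
   \int[mu]_(x in J) (b x + cst (T J - larger_sum J) x)%:E)%E.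
  apply: ae_eq_integral => //.
  - apply/measurable_EFinP; apply: measurableT_comp => //.
    by apply: measurable_funTS; exact: measurable_funD.
  - by apply/measurable_EFinP; apply: measurable_funTS; exact: measurable_funD.
  apply: (ae_mono (symbol_ge DJ)) => x bx Jx; have {}bx := bx Jx.
  by rewrite ger0_norm//=; lra.
rewrite -[leLHS]fineK; last by apply: integrable_fin_num.
rewrite lee_fin -/(Rintegral mu J (fun x => b x + cst (T J - larger_sum J) x)).
rewrite RintegralD//.
rewrite -(len_avg hD _ DJ) avg_symbol// (@Rintegral_cst _ _ _ mu J mJ) -/(len J).
by rewrite le_eqVlt; apply/orP; left; apply/eqP; ring.
Qed.

Lemma symbol_BMO : BMO D w b.
Proof.
split; first exact: symbol_locally_integrable.
apply: (@le_lt_trans _ _ (2 * (A * L `^ p))%:E); last exact: ltry.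
apply: ge_ereal_sup => _ [J DJ <-].
have J0 := len_gt0 hD DJ.
have TA : T J <= A * L `^ p * avg w J.
  by rewrite -lee_fin -tau_fin//; exact: (tau_le hD p1 hw hS).
have key : (\int[mu]_(x in J) `|b x - avg b J|%:E <=
    (2 * (A * L `^ p) * Rintegral mu J w)%:E)%E.
  apply: (le_trans (symbol_oscillation DJ)); rewrite lee_fin -(len_avg hD w DJ).
  have len2 : 0 <= 2 * len J by rewrite mulr_ge0// ltW.
  apply: (le_trans (ler_wpM2l len2 TA)).
  by rewrite le_eqVlt; apply/orP; left; apply/eqP; ring.
have w0 := Rintegral_weight_ge0 hD hw DJ.
rewrite (wmassE hD hw DJ); have [w0'|wn0] := eqVneq (Rintegral mu J w) 0.
  have -> : (\int[mu]_(x in J) `|b x - avg b J|%:E = 0)%E.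
    apply/eqP; rewrite eq_le integral_ge0 ?andbT//.
    by apply: (le_trans key); rewrite w0' mulr0.
  rewrite mule0 lee_fin !mulr_ge0 ?powR_ge0//; exact: (Ap_const_ge0 hD hw).
have wp : 0 < Rintegral mu J w by rewrite lt_neqAle eq_sym wn0.
by rewrite inver (negbTE wn0) lee_pdivrMl// -EFinM mulrC.
Qed.

End sparse_symbol.

(** * Sums over the grid, scale by scale *)

Section summation_by_scale.
Context {R : realType} {D : set (set R)} (hD : dyadic_grid D).
Implicit Types (I J K : set R) (x y : R) (k : int) (F : set R -> R -> R).

Lemma cell_inj x : injective (fun k => cell D k x).
Proof.
move=> k l E; have : (2 : R) ^ k = 2 ^ l by rewrite -(len_cell hD k x) E len_cell.
move=> H; apply/eqP; rewrite eq_le -(@ler_eXz2l R 2) ?ltr1n// H lexx/=.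
by rewrite -(@ler_eXz2l R 2) ?ltr1n// H lexx.
Qed.

(** Only the cells of x contribute at x. *)
Lemma dyadic_psumE F x m n : (forall J y, ~ J y -> F J y = 0) ->
  dyadic_psum D F x (m, n) =
  \sum_(0 <= i < m + n + 1) F (cell D (i%:Z - m%:Z) x) x.
Proof.
move=> F0; rewrite /dyadic_psum/=.
set A := [set J | _].
pose e (i : nat) := cell D (i%:Z - m%:Z) x.
have eA : e @` `I_(m + n + 1) `<=` A.
  move=> _ [i /= im <-]; split; first exact: cell_grid.
  rewrite len_cell// exprnN exprnP !ler_eXz2l ?ltr1n//.
  by apply/andP; split; lia.
rewrite -(fsbig_widen (e @` `I_(m + n + 1)) A)//; last first.
  move=> J [[DJ /andP[h1 h2]] nJ]; apply: F0 => Jx; apply: nJ.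
  have [k Jk] := grid_len hD DJ; move: h1 h2.
  rewrite Jk exprnN exprnP !ler_eXz2l ?ltr1n// => h1 h2.
  exists (absz (k + m%:Z)) => /=; first by lia.
  by rewrite /e; apply/esym/(cell_eq hD DJ _ Jx); rewrite Jk; congr (_ ^ _); lia.
rewrite (reindex_fsbig e `I_(m + n + 1)).
  by rewrite -(@fsbig_ord _ _ _ (m + n + 1) (fun i => F (e i) x)) big_mkord.
apply: inj_bij => i j _ _ /(cell_inj (x := x)); lia.
Qed.

Lemma eventually_small (F : set (set R)) x : finite_set F ->
  (forall I, F I -> D I /\ I x) ->
  exists N : nat, forall n, (N <= n)%N -> forall I, F I ->
    cell D (- n%:Z) x `<=` I /\ 2 ^- n <= len I <= 2 ^+ n.
Proof.
move=> /finite_seqP[t ->]; elim: t => [|I t IH] FD.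
  by exists 0%N => n _ I /=.
have [J|N HN] := IH; first by move=> Jt; apply: FD => /=; rewrite inE Jt orbT.
have [DI Ix] : D I /\ I x by apply: FD => /=; rewrite inE eqxx.
have [k Ik] := grid_len hD DI.
exists (maxn N (absz k)) => n; rewrite geq_max => /andP[Nn kn] J /=.
rewrite inE => /orP[/eqP ->|Jt]; last exact: HN.
rewrite exprnN exprnP Ik !ler_eXz2l ?ltr1n//; split; last first.
  by apply/andP; split; lia.
have -> : I = cell D k x by exact: (cell_eq hD DI).
by apply: cell_subset => //; lia.
Qed.

Lemma sum_scales (phi : int -> R) m n :
  \sum_(0 <= i < m + n + 1) phi (i%:Z - m%:Z) =
  \sum_(0 <= j < m.+1) phi (- j%:Z) + \sum_(0 <= j < n) phi (j.+1%:Z).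
Proof.
rewrite (@big_cat_nat _ _ _ m.+1)//=; last by lia.
congr (_ + _).
  rewrite big_nat_rev /=; apply: eq_big_nat => i /= im; congr phi; lia.
rewrite -{1}[m.+1]add0n big_addn (_ : m + n + 1 - m.+1 = n)%N; last by lia.
by apply: eq_big_nat => i _; congr phi; lia.
Qed.

Lemma cvg_scales (u v : nat -> R) (a b : R) :
  u @ \oo --> a -> v @ \oo --> b ->
  (fun mn : nat * nat => u mn.1 + v mn.2) @ filter_prod \oo \oo --> a + b.
Proof.
move=> ua vb; apply: cvgD.
  exact: (cvg_comp _ _ (@cvg_fst _ _ \oo \oo _) ua).
exact: (cvg_comp _ _ (@cvg_snd _ _ \oo \oo _) vb).
Qed.

Lemma is_cvg_dyadic_psum F x (phi : int -> R) :
  (forall J y, ~ J y -> F J y = 0) -> (forall k, F (cell D k x) x = phi k) ->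
  cvgn (fun m => \sum_(0 <= j < m) phi (- j%:Z)) ->
  cvgn (fun n => \sum_(0 <= j < n) phi (j.+1%:Z)) ->
  exists a : R, dyadic_psum D F x @ filter_prod \oo \oo --> a.
Proof.
move=> F0 FE /cvg_ex[a ca] /cvg_ex[b cb]; exists (a + b).
have ca' : (fun m => \sum_(0 <= j < m.+1) phi (- j%:Z)) @ \oo --> a.
  by move: ca; rewrite -cvg_shiftS.
rewrite (_ : dyadic_psum D F x = fun mn =>
    \sum_(0 <= j < mn.1.+1) phi (- j%:Z) +
    \sum_(0 <= j < mn.2) phi (j.+1%:Z)); first exact: cvg_scales ca' cb.
apply/funext => -[m n]; rewrite dyadic_psumE// -sum_scales.
by apply: eq_bigr => i _; exact: FE.
Qed.

Lemma dyadic_sumP F x (a : R) : dyadic_psum D F x @ filter_prod \oo \oo --> a ->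
  dyadic_summable D F x /\ dyadic_sum D F x = a.
Proof.
move=> h; split; first by apply/cvg_ex; exists a.
by apply: cvg_lim h => //; exact: Rhausdorff.
Qed.

Lemma dominated_sum_cvg (u v : nat -> R) (M : R) : (forall n, `|u n| <= v n) ->
  (forall n, \sum_(0 <= j < n) v j <= M) ->
  cvgn (fun n => \sum_(0 <= j < n) u j).
Proof.
move=> uv vM; have v0 n : 0 <= v n by rewrite (le_trans _ (uv n)).
have cv : cvgn (series v).
  apply: nondecreasing_is_cvgn.
    by apply: nondecreasing_series => n _ _; exact: v0.
  by exists M => _ [n _ <-]; exact: vM.
have : cvgn (series u); last exact.
apply: (@normed_cvg R R u); exact: (@series_le_cvg R (fun n => `|u n|) v
  (fun n => normr_ge0 _) v0 uv cv).
Qed.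

End summation_by_scale.

(** * The decomposition *)

Section decomposition.
Context {R : realType} {D : set (set R)} (hD : dyadic_grid D).
Variables (w : R -> R) (p L : R) (S : set (set R)).
Implicit Types (I J K : set R) (x y : R) (k : int).
Hypotheses (p1 : 1 < p) (hw : Ap D p w) (hS : Carleson D S L)
  (hchain : ~ infinite_increasing_chain S).
Local Notation mu := (@lebesgue_measure R).
Local Notation A := (fine (Ap_const D p w)).
Local Notation b := (sparse_symbol S w).
Local Notation T := (fun J => fine (tau S w J)).
Local Notation s := (larger_sum w S).
Local Notation c := (cell D).

Let lb : locally_integrable setT b.
Proof. exact: (symbol_locally_integrable hD hw hS hchain p1). Qed.

Let wI0 I : S I -> 0 <= avg w I.
Proof. by move=> /(sparse_grid hS); exact: (avg_weight_ge0 hD hw). Qed.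

Let avg_bE J : D J -> avg b J = T J + s J.
Proof. exact: (avg_symbol hD hw hS hchain p1). Qed.

Lemma symbol_increment J K : D J -> D K -> K `<=` J -> len K = len J / 2 ->
  avg b K - avg b J = T K + (if `[< S K >] then avg w K else 0) - T J.
Proof.
move=> DJ DK KJ lK; rewrite !avg_bE//.
by rewrite (larger_sum_child hD hw hS hchain DJ DK KJ lK); ring.
Qed.

Let symbol_esum x : finite_set [set I | S I /\ I x] ->
  (b x)%:E = (\esum_(I in [set I | S I /\ I x]) (avg w I)%:E)%E.
Proof.
move=> fx.
have E : (\esum_(I in S) (avg w I * \1_I x)%:E =
    \esum_(I in [set I | S I /\ I x]) (avg w I)%:E)%E.
  rewrite esum_mkcond [RHS]esum_mkcond; apply: eq_esum => I _.
  case: ifPn => [|/negP]; rewrite inE => SI;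
    case: ifPn => [|/negP]; rewrite inE //=.
  - by move=> [_ Ix]; rewrite indicE mem_set ?mulr1.
  - by move=> nSI; rewrite indicE memNset ?mulr0// => Ix; apply: nSI.
  - by move=> [].
rewrite /sparse_symbol E fineK// esum_fset//; last first.
  by move=> I; rewrite inE => -[SI _]; rewrite lee_fin wI0.
by rewrite fsbig_finite//= sumEFin.
Qed.

(** The averages of the symbol tend to its value by Lebesgue's theorem. When the
    cell of x is smaller than the finitely many members of S that contain x, the
    constant part of the symbol equals that value too, and tau is their difference. *)
Lemma tau_cvg0 : {ae mu, forall x, T (c (- n%:Z) x) @[n --> \oo] --> 0}.
Proof.
have fin := ae_finite_members hD hS hchain.
apply: (ae_mono (ae_and (avg_cvg hD lb) fin)) => x [bx fx].
have sx : s (c (- n%:Z) x) @[n --> \oo] --> b x.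
  apply: cvg_near_cst.
  have [|N HN] := @eventually_small _ _ hD [set I | S I /\ I x] x fx.
    by move=> I [SI Ix]; split => //; exact: (sparse_grid hS).
  exists N => // n /= Nn; apply: EFin_inj.
  rewrite -(esum_larger hD hw hS hchain (cell_grid hD _ _)) symbol_esum//.
  congr esum; apply/seteqP; split => I /= [SI h]; split => //.
    by apply: h; exact: mem_cell.
  by have [] := HN _ Nn I (conj SI h).
rewrite (_ : (fun n => _) =
    (fun n : nat => avg b (c (- n%:Z) x) - s (c (- n%:Z) x))).
  by rewrite -(subrr (b x)); exact: cvgB.
by apply/funext => n; rewrite (avg_bE (cell_grid hD _ _)) addrK.
Qed.

Variables (f : R -> R).
Hypothesis hf : sparse_domain D w f.

Let lf : locally_integrable setT f. Proof. by case: hf. Qed.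

Let pi_term k x := avg f (c k x) * avg_incr D b k x.
Let tau_term k x := T (c k x) * avg_incr D f k x.

Let paraproduct_termE k x : x != midpoint (c k x) ->
  paraproduct_term b f (c k x) x = pi_term k x.
Proof.
by move=> xm; rewrite /paraproduct_term mulrAC (inner_haar_mul hD)// mulrC.
Qed.

Let paraproduct_adj_termE k x : x != midpoint (c k x) ->
  paraproduct_adj_term b f (c k x) x = avg_incr D b k x * avg_incr D f k x.
Proof.
move=> xm; rewrite /paraproduct_adj_term indicE mem_set; last exact: mem_cell.
rewrite -(haar_sqr hD xm) -!(inner_haar_mul hD)//; ring.
Qed.

Let haar_multiplier_termE k x : x != midpoint (c k x) ->
  haar_multiplier_term T f (c k x) x = tau_term k x.
Proof.
by move=> xm; rewrite /haar_multiplier_term -mulrA (inner_haar_mul hD).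
Qed.

Let sparse_term J y :=
  if `[< S J >] then avg w J * avg f J * \1_J y else 0.

Let tau_avg k x := T (c k x) * avg f (c k x).

(** With F the average of f, the three terms at J for x in the child K add up to
    (b_K - b_J) F_K + tau_J (F_K - F_J), where b_K - b_J is
    tau_K - tau_J, plus w_K if K belongs to S. *)
Lemma telescope_terms k x : x != midpoint (c k x) ->
  paraproduct_term b f (c k x) x + paraproduct_adj_term b f (c k x) x +
    haar_multiplier_term T f (c k x) x =
  sparse_term (c (k - 1) x) x - (tau_avg k x - tau_avg (k - 1) x).
Proof.
move=> xm; have [sub ll] := cell_step hD k x.
rewrite paraproduct_termE// paraproduct_adj_termE// haar_multiplier_termE//.
have := symbol_increment (cell_grid hD k x) (cell_grid hD (k - 1) x) sub ll.
rewrite /pi_term /tau_term /avg_incr => ->; rewrite /sparse_term /tau_avg.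
case: asboolP => _; last by ring.
rewrite indicE mem_set; first by rewrite /=; ring.
exact: mem_cell.
Qed.

Let paraproduct_term_out J y : ~ J y -> paraproduct_term b f J y = 0.
Proof. by move=> nJ; rewrite /paraproduct_term haar_out// mulr0. Qed.

Let paraproduct_adj_term_out J y : ~ J y -> paraproduct_adj_term b f J y = 0.
Proof.
by move=> nJ; rewrite /paraproduct_adj_term indicE memNset// mul0r mulr0.
Qed.

Let haar_multiplier_term_out J y : ~ J y -> haar_multiplier_term T f J y = 0.
Proof. by move=> nJ; rewrite /haar_multiplier_term haar_out// mulr0. Qed.

Let sparse_term_out J y : ~ J y -> sparse_term J y = 0.
Proof.
by move=> nJ; rewrite /sparse_term indicE memNset// mulr0; case: ifP.
Qed.

Let wf n x := avg w (c n%:Z x) * `|avg f (c n%:Z x)|.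

Let wf_ge0 n x : 0 <= wf n x.
Proof. by rewrite mulr_ge0// (avg_weight_ge0 hD hw)//; exact: cell_grid. Qed.

Lemma large_scale_bound x :
  exists M : R, forall n, \sum_(0 <= j < n) wf j x <= M.
Proof.
case: hf => _ /(_ (c 0 x) (cell_grid hD 0 x)).
set E := (\esum_(_ in _) _)%E => Efin.
have EP J : D J -> (0 <= (avg w J * `|avg f J|)%:E)%E.
  by move=> DJ; rewrite lee_fin mulr_ge0// (avg_weight_ge0 hD hw).
have E0 : (0 <= E)%E by apply: esum_ge0 => J [DJ _]; exact: EP.
exists (fine E) => n; rewrite -lee_fin fineK ?ge0_fin_numE//.
have us : uniq [seq c (j%:Z) x | j <- iota 0 n].
  by rewrite map_inj_uniq ?iota_uniq// => i j /(cell_inj hD (x := x)) [].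
apply: esum_ge; exists [set` [seq c (j%:Z) x | j <- iota 0 n]].
  split; [exact: finite_seq|move=> J /= /mapP[j _ ->]].
  by split; [exact: cell_grid|exact: cell_subset].
by rewrite -fsbig_seq// big_map -sumEFin /index_iota subn0.
Qed.

Let C := A * L `^ p.

Let C_ge0 : 0 <= C.
Proof. by rewrite mulr_ge0 ?powR_ge0// (Ap_const_ge0 hD hw). Qed.

Let tau_bounds J : D J -> 0 <= T J <= C * avg w J.
Proof.
move=> DJ; rewrite fine_ge0 ?(tau_ge0 hD hw hS)//= -lee_fin.
by rewrite -(tau_fin hD hw hS p1)//; exact: (tau_le hD p1 hw hS).
Qed.

Lemma pi_term_le (j : nat) x :
  `|pi_term j.+1%:Z x| <= (3 * C + 2) * wf j.+1 x.
Proof.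
have [sub ll] := cell_step hD j.+1%:Z x.
have Dk := cell_grid hD j.+1%:Z x; have Dk' := cell_grid hD (j.+1%:Z - 1) x.
rewrite /pi_term /avg_incr (symbol_increment Dk Dk' sub ll) /wf.
have h := avg_weight_child hD hw Dk Dk' sub ll.
have /andP[a0 a1] := tau_bounds Dk; have /andP[b0 b1] := tau_bounds Dk'.
have w0 := avg_weight_ge0 hD hw Dk'; have w1 := avg_weight_ge0 hD hw Dk.
have h' := ler_wpM2l C_ge0 h; have Cw := mulr_ge0 C_ge0 w1.
rewrite normrM mulrC [X in _ <= X]mulrA; apply: ler_wpM2r => //.
by rewrite ler_norml; apply/andP; split; case: asboolP => _; lra.
Qed.

(** The average of f on the smaller cell is paired with the weight of the larger
    one, which calls for doubling. *)
Lemma tau_term_le (j : nat) x :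
  `|tau_term j.+1%:Z x| <= C * (A * 2 `^ p / 2) * wf j x + C * wf j.+1 x.
Proof.
have [sub ll] := cell_step hD j.+1%:Z x.
have Dk := cell_grid hD j.+1%:Z x; have Dk' := cell_grid hD (j.+1%:Z - 1) x.
have dbl := Ap_doubling hD p1 hw Dk Dk' sub ll; have CA := C_ge0.
have /andP[a0 a1] := tau_bounds Dk; rewrite /tau_term /avg_incr /wf.
rewrite (_ : j.+1%:Z - 1 = j%:Z) in dbl *; last by lia.
rewrite normrM ger0_norm//.
have n1 := ler_normB (avg f (c j%:Z x)) (avg f (c j.+1%:Z x)).
apply: (le_trans (ler_wpM2l a0 n1)); rewrite mulrDr.
move: dbl a1 (avg_weight_ge0 hD hw Dk).
move: (avg w (c j.+1%:Z x)) (avg w (c j%:Z x)) => u v dbl a1 u0; apply: lerD.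
  rewrite mulrA; apply: ler_wpM2r => //; apply: (le_trans a1).
  by rewrite -mulrA; apply: ler_wpM2l.
by rewrite mulrA; apply: ler_wpM2r.
Qed.

Let sum_shift (M : R) x : (forall n, \sum_(0 <= j < n) wf j x <= M) ->
  forall n, \sum_(0 <= j < n) wf j.+1 x <= M.
Proof.
move=> wfM n; apply: le_trans (wfM n.+1).
by rewrite big_nat_recl// lerDr; exact: wf_ge0.
Qed.

Lemma large_pi_cvg x :
  cvgn (fun n => \sum_(0 <= j < n) pi_term j.+1%:Z x).
Proof.
have [M wfM] := large_scale_bound x.
apply: (@dominated_sum_cvg _ _ (fun j => (3 * C + 2) * wf j.+1 x)
  ((3 * C + 2) * M)) => [j|n]; first exact: pi_term_le.
rewrite -mulr_sumr ler_wpM2l ?sum_shift//.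
by rewrite addr_ge0// mulr_ge0// C_ge0.
Qed.

Lemma large_tau_cvg x :
  cvgn (fun n => \sum_(0 <= j < n) tau_term j.+1%:Z x).
Proof.
have [M wfM] := large_scale_bound x.
apply: (@dominated_sum_cvg _ _
  (fun j => C * (A * 2 `^ p / 2) * wf j x + C * wf j.+1 x)
  (C * (A * 2 `^ p / 2) * M + C * M)) => [j|n]; first exact: tau_term_le.
have CA := C_ge0.
rewrite big_split/= -!mulr_sumr lerD// ler_wpM2l ?sum_shift//.
by rewrite !mulr_ge0 ?invr_ge0 ?powR_ge0// (Ap_const_ge0 hD hw).
Qed.

Lemma large_tau_avg_cvg0 x : (fun n : nat => tau_avg n%:Z x) @ \oo --> 0.
Proof.
have [M wfM] := large_scale_bound x.
have cwf : cvgn (series (fun n => wf n x)).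
  apply: nondecreasing_is_cvgn.
    by apply: nondecreasing_series => n _ _; exact: wf_ge0.
  by exists M => _ [n _ <-]; exact: wfM.
have Cwf : (fun n => C * wf n x) @ \oo --> 0.
  rewrite -(mulr0 C); apply: cvgM; first exact: cvg_cst.
  exact: cvg_series_cvg_0 cwf.
apply: (@squeeze_cvgr _ _ _ _ (fun n => - (C * wf n x)) (fun n => C * wf n x))
  => //; last by rewrite -oppr0; exact: cvgN.
apply: nearW => n; rewrite -ler_norml /tau_avg normrM /wf mulrA.
have /andP[a0 a1] := tau_bounds (cell_grid hD n%:Z x).
by rewrite ger0_norm//; apply: ler_wpM2r.
Qed.

Let psum_sparse x : finite_set [set I | S I /\ I x] -> exists N, forall m n,
  (N <= m)%N -> (N <= n)%N ->
  dyadic_psum D sparse_term x (m, n) = sparse_op S w f x.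
Proof.
move=> fx; have [|N HN] := @eventually_small _ _ hD [set I | S I /\ I x] x fx.
  by move=> I [SI Ix]; split => //; exact: (sparse_grid hS).
exists N => m n Nm Nn; rewrite /dyadic_psum /sparse_op /=.
rewrite -(fsbig_widen [set I | S I /\ I x] S)/=; last 2 first.
- by move=> I [].
- move=> I [SI nI] /=; rewrite indicE memNset ?mulr0// => Ix.
  by apply: nI.
rewrite -(fsbig_widen [set I | S I /\ I x] [set J | _ /\ _])/=; last 2 first.
- move=> I FI; have [_ /andP[h1 _]] := HN _ Nm _ FI.
  have [_ /andP[_ h2]] := HN _ Nn _ FI.
  by split; [case: FI => SI _; exact: (sparse_grid hS)|rewrite h1].
- move=> I [_ nI] /=; rewrite /sparse_term; case: asboolP => // SI.
  by rewrite indicE memNset ?mulr0// => Ix; apply: nI.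
apply: eq_fsbigr => I; rewrite inE => -[SI _].
by rewrite /sparse_term asboolT.
Qed.

(** The sum of the three series telescopes: over the scales -m .. n it is the
    partial sum of the sparse operator over the scales -m-1 .. n-1, up to the two
    boundary terms, which vanish in the limit. *)
Lemma three_terms_cvg x : finite_set [set I | S I /\ I x] ->
  (forall k, x != midpoint (c k x)) ->
  T (c (- n%:Z) x) @[n --> \oo] --> 0 ->
  cvgn (fun n => avg f (c (- n%:Z) x)) ->
  (fun mn => dyadic_psum D (paraproduct_term b f) x mn +
    dyadic_psum D (paraproduct_adj_term b f) x mn +
    dyadic_psum D (haar_multiplier_term T f) x mn) @ filter_prod \oo \oo -->
  sparse_op S w f x.
Proof.
move=> fx xm Tx favg.
have small : (fun m : nat => tau_avg (- m.+1%:Z) x) @ \oo --> 0.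
  have : (fun m : nat => tau_avg (- m%:Z) x) @ \oo --> 0.
    by move/cvg_ex: favg => [a ca]; rewrite -(mul0r a); exact: cvgM.
  by rewrite -cvg_shiftS.
have large : (fun n : nat => sparse_op S w f x - tau_avg n%:Z x) @ \oo -->
    sparse_op S w f x.
  rewrite -[X in _ --> X]subr0; apply: cvgB; first exact: cvg_cst.
  exact: large_tau_avg_cvg0.
have := cvg_scales small large; rewrite add0r; apply: cvg_trans.
apply: near_eq_cvg; have [N HN] := psum_sparse fx.
exists ([set m | (N <= m)%N], [set n | (N.+1 <= n)%N]) => /=.
  by split; [exists N|exists N.+1].
move=> [m [|n]] [/= Nm Nn] //.
rewrite !dyadic_psumE// -!big_split/=.
under eq_bigr => i _ do rewrite telescope_terms//.
rewrite (eq_bigr (fun i : nat => sparse_term (c (i%:Z - m.+1%:Z) x) x -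
    (tau_avg (i.+1%:Z - m.+1%:Z) x - tau_avg (i%:Z - m.+1%:Z) x))); last first.
  move=> i _; rewrite (_ : i%:Z - m%:Z - 1 = i%:Z - m.+1%:Z); last by lia.
  by rewrite (_ : i%:Z - m%:Z = i.+1%:Z - m.+1%:Z); last by lia.
rewrite sumrB (telescope_sumr (fun i : nat => tau_avg (i%:Z - m.+1%:Z) x))//.
rewrite -(HN m.+1 n) ?dyadic_psumE//; last exact: leqW.
rewrite (_ : m.+1 + n + 1 = m + n.+1 + 1)%N; last by lia.
rewrite (_ : (m + n.+1 + 1)%N%:Z - m.+1%:Z = n.+1%:Z); last by lia.
by rewrite sub0r; ring.
Qed.

Lemma decomposition_at x : finite_set [set I | S I /\ I x] ->
  (forall k, x != midpoint (c k x)) ->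
  T (c (- n%:Z) x) @[n --> \oo] --> 0 ->
  cvgn (fun n => avg f (c (- n%:Z) x)) ->
  cvgn (fun n => \sum_(0 <= j < n) pi_term (- j%:Z) x) ->
  cvgn (fun n => \sum_(0 <= j < n) tau_term (- j%:Z) x) ->
  [/\ dyadic_summable D (paraproduct_term b f) x,
      dyadic_summable D (paraproduct_adj_term b f) x,
      dyadic_summable D (haar_multiplier_term T f) x &
      sparse_op S w f x = paraproduct D b f x
        + paraproduct_adj D b f x + haar_multiplier D T f x].
Proof.
move=> fx xm Tx favg small_pi small_tau.
have [a1 c1] := is_cvg_dyadic_psum hD paraproduct_term_out
  (fun k => paraproduct_termE (xm k)) small_pi (@large_pi_cvg x).
have [a3 c3] := is_cvg_dyadic_psum hD haar_multiplier_term_out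
  (fun k => haar_multiplier_termE (xm k)) small_tau (@large_tau_cvg x).
have tot := three_terms_cvg fx xm Tx favg.
have c2 : dyadic_psum D (paraproduct_adj_term b f) x @ filter_prod \oo \oo -->
    sparse_op S w f x - a1 - a3.
  rewrite (_ : dyadic_psum D (paraproduct_adj_term b f) x = fun mn =>
      dyadic_psum D (paraproduct_term b f) x mn +
      dyadic_psum D (paraproduct_adj_term b f) x mn +
      dyadic_psum D (haar_multiplier_term T f) x mn -
      dyadic_psum D (paraproduct_term b f) x mn -
      dyadic_psum D (haar_multiplier_term T f) x mn).
    exact: (cvgB (cvgB tot c1) c3).
  by apply/funext => mn; ring.
have [s1 e1] := dyadic_sumP c1; have [s2 e2] := dyadic_sumP c2.
have [s3 e3] := dyadic_sumP c3.
split => //; rewrite /paraproduct /paraproduct_adj /haar_multiplier e1 e2 e3.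
by ring.
Qed.

(** At small scales the first and the third series are martingale transforms: of
    the symbol by the averages of f, and of f by tau. Both multipliers are bounded
    along almost every chain of cells, because they converge. *)
Lemma ae_decomposition : {ae mu, forall x,
  [/\ dyadic_summable D (paraproduct_term b f) x,
      dyadic_summable D (paraproduct_adj_term b f) x,
      dyadic_summable D (haar_multiplier_term T f) x &
      sparse_op S w f x = paraproduct D b f x
        + paraproduct_adj D b f x + haar_multiplier D T f x]}.
Proof.
have bdd (u v : nat -> R) (a d : R) : u @ \oo --> a -> v @ \oo --> d ->
    exists M : R, forall n, `|u n| <= M /\ v n <= M.
  have bound (u' : nat -> R) (a' : R) : u' @ \oo --> a' ->
      exists M, forall n, `|u' n| <= M.
    move=> ua; have /cvg_seq_bounded : cvgn u' by apply/cvg_ex; exists a'.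
    by case=> M [_ HM]; exists (M + 1) => n; apply: HM => //; rewrite ltrDl.
  move=> /bound[M1 h1] /bound[M2 h2]; exists (Num.max M1 M2) => n.
  by rewrite !le_max h1 (le_trans (ler_norm _) (h2 n)) orbT.
have cf := avg_cvg hD lf.
have cnb := avg_cvg hD (locally_integrable_norm lb).
have cnf := avg_cvg hD (locally_integrable_norm lf).
have small_pi := @transform_cvg _ _ hD b (avg f) lb
  (ae_mono (ae_and cf cnb) (fun x h => bdd _ _ _ _ h.1 h.2)).
have small_tau := @transform_cvg _ _ hD f T lf
  (ae_mono (ae_and tau_cvg0 cnf) (fun x h => bdd _ _ _ _ h.1 h.2)).
have fin := ae_finite_members hD hS hchain.
have good := ae_and (ae_and fin (ae_not_midpoint hD)) (ae_and tau_cvg0 cf).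
apply: (ae_mono (ae_and good (ae_and small_pi small_tau))).
move=> x [[[h1 h2] [h3 h4]] [h5 h6]]; apply: decomposition_at => //.
by apply/cvg_ex; exists (f x).
Qed.

End decomposition.

Unset Implicit Arguments.

Theorem proposition2p4 (R : realType) (p L : R) (D S : set (set R))
    (w : R -> R) (hp : 1 < p) (hD : dyadic_grid D) (hw : Ap D p w)
    (hS : Carleson D S L) (hchain : ~ infinite_increasing_chain S) :
  [/\ {ae @lebesgue_measure R, forall x, finite_set [set I | S I /\ I x]},
      BMO D w (sparse_symbol S w),
      forall J, D J ->
        (tau S w J <= Ap_const D p w * (L `^ p)%:E * eavg w J)%E &
      forall f : R -> R, sparse_domain D w f ->
        let b := sparse_symbol S w in
        let t := fun J => fine (tau S w J) in
        {ae @lebesgue_measure R, forall x,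
          [/\ dyadic_summable D (paraproduct_term b f) x,
              dyadic_summable D (paraproduct_adj_term b f) x,
              dyadic_summable D (haar_multiplier_term t f) x &
              sparse_op S w f x = paraproduct D b f x
                + paraproduct_adj D b f x + haar_multiplier D t f x]}].
Proof.
split.
- exact: (ae_finite_members hD hS hchain).
- exact: (symbol_BMO hD hw hS hchain hp).
- move=> J DJ; rewrite (eavgE hD hw DJ) -(fineK (Ap_const_fin hD hw)) -!EFinM.
  exact: (tau_le hD hp hw hS).
- by move=> f hf b t; exact: (ae_decomposition hD hp hw hS hchain hf).
Qed.
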